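(* There is a hole in $\mathcal{M}_0$; that is, $\mathbb{D}^*\setminus\mathcal{M}_0$ has a connected component other than the component containing $\{z:0<|z|<1/2\}$.
   Context: For $z\in\mathbb{D}^*=\{0<|z|<1\}$ let $f(x)=zx$, $g(x)=z(x-1)+1$, and let $\Lambda_z$ be the unique nonempty compact subset of $\mathbb{C}$ with $\Lambda_z=f(\Lambda_z)\cup g(\Lambda_z)$. Define $\mathcal{M}_0=\{z\in\mathbb{D}^*:1/2\in\Lambda_z\}$; it is contained in $\{|z|\ge1/2\}$. *)

(* Defs.v *)
(* The complex plane C is modelled as R * R
   (Stdlib reals, which form a realType), with the product topology. *)
From HB Require Import structures.
From mathcomp Require Import all_boot all_order all_algebra.
From mathcomp Require Import all_classical all_reals all_analysis.
From mathcomp Require Import Rstruct Rstruct_topology.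
Set Implicit Arguments. Unset Strict Implicit. Unset Printing Implicit Defensive.
Import Order.TTheory GRing.Theory Num.Theory.
Local Open Scope ring_scope.
Local Open Scope classical_set_scope.

Notation R := Rdefinitions.R.

Definition Cplx := (R * R)%type.

Definition cadd (a b : Cplx) : Cplx := (a.1 + b.1, a.2 + b.2).
Definition csub (a b : Cplx) : Cplx := (a.1 - b.1, a.2 - b.2).
Definition cmul (a b : Cplx) : Cplx :=
  (a.1 * b.1 - a.2 * b.2, a.1 * b.2 + a.2 * b.1).
Definition cabs (a : Cplx) : R := Num.sqrt (a.1 ^+ 2 + a.2 ^+ 2).
Definition cone : Cplx := (1, 0).
Definition chalf : Cplx := (2^-1, 0).

Definition fmap (z : Cplx) (x : Cplx) : Cplx := cmul z x.
Definition gmap (z : Cplx) (x : Cplx) : Cplx := cadd (cmul z (csub x cone)) cone.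

Definition is_attractor (z : Cplx) (L : set Cplx) : Prop :=
  L !=set0 /\ compact L /\ L = (fmap z @` L) `|` (gmap z @` L).

Definition Dstar : set Cplx := [set z | 0 < cabs z < 1].

Definition M0 : set Cplx :=
  [set z | Dstar z /\ exists L, is_attractor z L /\ L chalf].

(* Main.v *)
From Stdlib Require Import ZArith Reals Lra Lia List.
From Coquelicot Require Import Rcomplements Complex.
Require Import Defs.
From mathcomp Require Import all_boot all_order all_algebra.
From mathcomp Require Import all_classical all_reals all_analysis.
From mathcomp Require Import Rstruct Rstruct_topology.

(** Up to an affine change of variable the attractor consists of the sums of the series
    [sum e_i z^i] with [e_i = +-1], so [z] lies in [M0] iff, with [w = 1/z], the point 0 has an
    infinite bounded orbit under moves [x |-> (x -+ 1) w]; equivalently, for every [n] it has an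
    orbit of length [n] ending in the disc of radius [B], where [1 + B/|w| <= B].

    Near [w = 1/(0.6142234 + 0.436528 i)], where [2|z|^2 > 1], the set of all such sums contains
    a fat region [domain]: a quadtree of small squares certifies that every point of [domain]
    is carried back into [domain] by some word of moves, uniformly for [w] in a disc of radius
    [7.5e-6].  Hence if a word carries 0 into [domain] then [z] is in [M0].  Such words are
    listed for all [w] on the boundary of a square of half side [5.3e-6], while for one [w]
    inside the square every word of length 48 carries 0 out of the disc of radius [B].  The
    square's boundary therefore separates this point from [0 < |z| < 1/2] outside [M0]. *)

(* MathComp binds the key [Z] to its own [int_scope]. *)
Delimit Scope Z_scope with BZ.

(** * Ball arithmetic *)

Section BallArithmetic.
Local Open Scope R_scope.

(* Complex numbers are rounded to Gaussian integers in units of [1 / scale]. *)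
Definition prec : Z := 40.
Definition scale : Z := 1099511627776.

Record ball := Ball { re : Z; im : Z; rad : Z }.

Definition gauss (a b : Z) : C := (IZR a, IZR b).

Definition in_ball (X : C) (B : ball) : Prop :=
  Cmod (X - gauss (re B) (im B)) <= IZR (rad B).

Definition digit (e : bool) : Z := if e then scale else Z.opp scale.

(** For nonzero [w] this inverts [X |-> X / w + digit e]; [X] is counted in units of [1 / scale],
    while [w] stays unscaled. *)
Definition pull (w : C) (e : bool) (X : C) : C :=
  ((X - RtoC (IZR (digit e))) * w)%C.

(* The binary digits of [p] below the leading one, lowest first, are the moves. *)
Fixpoint pull_word (w : C) (p : positive) (X : C) : C :=
  match p with
  | xH => X
  | xI q => pull_word w q (pull w true X)
  | xO q => pull_word w q (pull w false X)
  end.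

Lemma scale_gt0 : 0 < IZR scale.
Proof. by apply: IZR_lt. Qed.

Lemma shiftr_floor (n : Z) :
  IZR n / IZR scale - 1 <= IZR (Z.shiftr n prec) <= IZR n / IZR scale.
Proof.
rewrite Z.shiftr_div_pow2 // (_ : (2 ^ prec = scale)%BZ) //.
have Hs := scale_gt0.
have Hm := Z_div_mod_eq_full n scale.
have [H0 H1] := Z.mod_pos_bound n scale ltac:(by []).
have E : IZR n = IZR scale * IZR (n / scale) + IZR (n mod scale).
  by rewrite {1}Hm plus_IZR mult_IZR.
have L0 := IZR_le _ _ H0. have L1 := IZR_lt _ _ H1.
have -> : IZR n / IZR scale = IZR (n / scale) + IZR (n mod scale) / IZR scale.
  by rewrite E; field; lra.
have : 0 <= IZR (n mod scale) / IZR scale <= 1.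
  split; first by apply: Rdiv_le_0_compat.
  by apply/Rle_div_l => //; lra.
by move=> [? ?]; split; lra.
Qed.

Lemma Cmod_le_abs (c : C) : Cmod c <= Rabs (fst c) + Rabs (snd c).
Proof.
case: c => x y /=.
have -> : ((x, y) : C) = ((x, 0) + (0, y))%C by rewrite /Cplus /=; f_equal; ring.
apply: Rle_trans (Cmod_triangle _ _) _.
rewrite /Cmod /= !Rmult_1_r !Rmult_0_l Rplus_0_r Rplus_0_l -/(Rsqr x) -/(Rsqr y) !sqrt_Rsqr_abs.
exact: Rle_refl.
Qed.

Lemma Rabs_fst_le_Cmod (c : C) : Rabs (fst c) <= Cmod c.
Proof. exact: Rle_trans (Rmax_l _ _) (Rmax_Cmod c). Qed.

Lemma Rabs_snd_le_Cmod (c : C) : Rabs (snd c) <= Cmod c.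
Proof. exact: Rle_trans (Rmax_r _ _) (Rmax_Cmod c). Qed.

Lemma Cmod_gauss_sqr (a b : Z) : Cmod (gauss a b) ^ 2 = IZR (a * a + b * b).
Proof. by rewrite /Cmod pow2_sqrt /= ?plus_IZR ?mult_IZR; [ring | nra]. Qed.

Lemma le_Cmod_gauss (a b n : Z) :
  (n * n <= a * a + b * b)%BZ -> IZR n <= Cmod (gauss a b).
Proof.
move=> /IZR_le; rewrite -Cmod_gauss_sqr mult_IZR => H.
have := Cmod_ge_0 (gauss a b); nra.
Qed.

Lemma Cmod_gauss_le (a b n : Z) :
  (0 <= n)%BZ -> (a * a + b * b <= n * n)%BZ -> Cmod (gauss a b) <= IZR n.
Proof.
move=> /IZR_le H0 /IZR_le; rewrite -Cmod_gauss_sqr mult_IZR => H.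
have := Cmod_ge_0 (gauss a b); nra.
Qed.

Lemma Cmod_gauss_lt (a b n : Z) :
  (0 <= n)%BZ -> (a * a + b * b < n * n)%BZ -> Cmod (gauss a b) < IZR n.
Proof.
move=> /IZR_le H0 /IZR_lt; rewrite -Cmod_gauss_sqr mult_IZR => H.
have := Cmod_ge_0 (gauss a b); nra.
Qed.

Lemma lt_Cmod_gauss (a b n : Z) :
  (n * n < a * a + b * b)%BZ -> IZR n < Cmod (gauss a b).
Proof.
move=> /IZR_lt; rewrite -Cmod_gauss_sqr mult_IZR => H.
have := Cmod_ge_0 (gauss a b); nra.
Qed.

Lemma gauss_sub (a b c d : Z) : (gauss a b - gauss c d)%C = gauss (a - c) (b - d).
Proof. by rewrite /gauss /Cminus /Cplus /Copp /= !minus_IZR. Qed.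

Lemma gauss_add (a b c d : Z) : (gauss a b + gauss c d)%C = gauss (a + c) (b + d).
Proof. by rewrite /gauss /Cplus /= !plus_IZR. Qed.

(* Bounds [|scaled w|] for the parameters [w] considered. *)
Definition kappa : Z := 1459131660764.

(** Here [(u, v)] approximates [scaled w] to within [d]. The [3] pays for rounding: one unit for
    each coordinate of the centre and one for rounding the radius itself down. *)
Definition ball_pull (u v d : Z) (e : bool) (B : ball) : ball :=
  let a := (re B - digit e)%BZ in
  let b := im B in
  Ball (Z.shiftr (a * u - b * v) prec) (Z.shiftr (a * v + b * u) prec)
       (Z.shiftr (kappa * rad B + d * (Z.abs a + Z.abs b)) prec + 3).

Fixpoint ball_pull_word (u v d : Z) (p : positive) (B : ball) : ball :=
  match p with
  | xH => B
  | xI q => ball_pull_word u v d q (ball_pull u v d true B)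
  | xO q => ball_pull_word u v d q (ball_pull u v d false B)
  end.

Definition scaled (w : C) : C := (RtoC (IZR scale) * w)%C.

Lemma ball_pull_sound (w : C) (u v d : Z) (e : bool) (X : C) (B : ball) :
  Cmod (scaled w - gauss u v) <= IZR d -> Cmod (scaled w) <= IZR kappa ->
  in_ball X B -> in_ball (pull w e X) (ball_pull u v d e B).
Proof.
case: B => a0 b r; rewrite /in_ball /ball_pull; cbn [re im rad] => Hw Hk HX.
set a := (a0 - digit e)%BZ.
have Ea : IZR a = IZR a0 - IZR (digit e) by rewrite minus_IZR.
clearbody a.
set P := (a * u - b * v)%BZ; set Q := (a * v + b * u)%BZ.
set T := (kappa * r + d * (Z.abs a + Z.abs b))%BZ.
have Hs := scale_gt0.
have Sn : IZR scale <> 0 by lra.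
have S0 : RtoC (IZR scale) <> 0%C by move=> /RtoC_inj.
have [P1 P2] := shiftr_floor P; have [Q1 Q2] := shiftr_floor Q.
have [T1 T2] := shiftr_floor T.
set E1 := ((X - gauss a0 b) * scaled w)%C.
set E2 := (gauss a b * (scaled w - gauss u v))%C.
set E3 : C := (IZR P / IZR scale - IZR (Z.shiftr P prec), IZR Q / IZR scale - IZR (Z.shiftr Q prec)).
have E : (pull w e X - gauss (Z.shiftr P prec) (Z.shiftr Q prec))%C
       = ((E1 + E2) * RtoC (/ IZR scale) + E3)%C.
  have Gp : gauss (Z.shiftr P prec) (Z.shiftr Q prec)
     = (gauss a b * gauss u v * RtoC (/ IZR scale) - E3)%C.
    rewrite /gauss /E3 /P /Q /Cminus /Cplus /Copp /Cmult /RtoC;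
      cbn [fst snd]; rewrite !minus_IZR !plus_IZR !mult_IZR.
    by congr pair; field; lra.
  have Ga : gauss a b = (gauss a0 b - RtoC (IZR (digit e)))%C.
    rewrite /gauss /RtoC /Cminus /Cplus /Copp; cbn [fst snd].
    by rewrite Ea; congr pair; ring.
  rewrite Gp /E1 /E2 /pull /scaled (RtoC_inv _ Sn) Ga.
  by field.
rewrite E plus_IZR.
apply: Rle_trans (Cmod_triangle _ _) _.
have H3 : Cmod E3 <= 2.
  apply: Rle_trans (Cmod_le_abs _) _.
  by rewrite /E3; cbn [fst snd]; rewrite !Rabs_pos_eq; lra.
rewrite Cmod_mult Cmod_R (Rabs_pos_eq (/ _)); last by left; apply: Rinv_0_lt_compat.
have H1 : Cmod E1 <= IZR kappa * IZR r.
  rewrite /E1 Cmod_mult Rmult_comm.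
  by apply: Rmult_le_compat => //; exact: Cmod_ge_0.
have H2 : Cmod E2 <= IZR d * (IZR (Z.abs a) + IZR (Z.abs b)).
  rewrite /E2 Cmod_mult Rmult_comm !abs_IZR.
  apply: Rmult_le_compat => //; try exact: Cmod_ge_0.
  exact: (Cmod_le_abs (gauss a b)).
have H12 : Cmod (E1 + E2) <= IZR T.
  rewrite /T plus_IZR !mult_IZR plus_IZR.
  by have := Cmod_triangle E1 E2; lra.
have : Cmod (E1 + E2) * / IZR scale <= IZR T / IZR scale.
  by apply: Rmult_le_compat_r => //; left; apply: Rinv_0_lt_compat.
by lra.
Qed.

Lemma ball_pull_word_sound (w : C) (u v d : Z) (p : positive) (X : C) (B : ball) :
  Cmod (scaled w - gauss u v) <= IZR d -> Cmod (scaled w) <= IZR kappa ->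
  in_ball X B -> in_ball (pull_word w p X) (ball_pull_word u v d p B).
Proof.
move=> Hw Hk; elim: p X B => [p IH|p IH|] X B HX //;
  cbn [pull_word ball_pull_word]; apply: IH; exact: ball_pull_sound.
Qed.

End BallArithmetic.

(** * The self-covering region *)

Section Domain.
Import ListNotations.
Local Open Scope Z_scope.

(** The square lies in the plane of [w = 1/z]. [half_diag] is [sqrt 2 * half_side] rounded up, so a
    disc of that radius contains the square; [bound] stands for the radius 4.06. *)
Definition centre_re : Z := 1189352542208.
Definition centre_im : Z := -845270183936.
Definition half_side : Z := 5827411.
Definition half_diag : Z := 8241204.
Definition bound : Z := 4464017208770.
(* [(al, be, ga, nu)] stands for the strip [|al x + be y| <= ga], and [nu] bounds the norm of
   [(al, be)] from above. *)
Definition strips : list (Z * Z * Z * Z) :=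
  [(32, 0, 36433597988864, 32); (30, 12, 37548423852032, 33); (23, 23, 36718540525568, 33);
  (12, 30, 33408465285120, 33); (0, 32, 26642177163264, 32); (-12, 30, 28100002250752, 33);
  (-23, 23, 29895599677440, 33); (-30, 12, 32426720649216, 33)].

(* [(x, y, h)] stands for the open discs of radius [h] around [(x, y)] and [(-x, -y)]. *)
Definition holes : list (Z * Z * Z) :=
  [(895010861056, 575872466944, 6746591232); (221523562496, 780071882752, 5561135104);
  (-5142724608, 6134616064, 6118408192); (51851264, 289210368, 6133125120)].

End Domain.

Section SelfCover.
Local Open Scope R_scope.

(** The strips cut out a centrally symmetric polygon. By [domain_survives] no point of [domain] may
    die for a parameter near the centre, whereas 0 dies at [base_point]; hence 0 must be removed,
    which the last entry of [holes] does. *)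
Definition domain (X : C) : Prop :=
  Forall (fun '(al, be, ga, _) =>
    Rabs (IZR al * fst X + IZR be * snd X) <= IZR ga) strips /\
  Forall (fun '(x, y, h) =>
    IZR h <= Cmod (X - gauss x y) /\ IZR h <= Cmod (X + gauss x y)) holes.

Definition sqn (a b : Z) : Z := (a * a + b * b)%BZ.

Definition ball_in_domain (B : ball) : bool :=
  let: Ball a b r := B in
  List.forallb (fun '(al, be, ga, nu) =>
    Z.leb (Z.abs (al * a + be * b) + nu * r) ga) strips &&
  List.forallb (fun '(x, y, h) =>
    Z.leb ((h + r) * (h + r)) (sqn (a - x) (b - y)) &&
    Z.leb ((h + r) * (h + r)) (sqn (a + x) (b + y))) holes.

(* The lower half-plane is discarded because [domain] is symmetric under [X |-> -X]. *)
Definition ball_outside (B : ball) : bool :=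
  let: Ball a b r := B in
  [|| List.existsb (fun '(al, be, ga, nu) =>
        Z.ltb (ga + nu * r) (Z.abs (al * a + be * b))) strips,
      Z.ltb (b + r) 0 |
      List.existsb (fun '(x, y, h) => Z.ltb r h &&
        (Z.ltb (sqn (a - x) (b - y)) ((h - r) * (h - r)) ||
         Z.ltb (sqn (a + x) (b + y)) ((h - r) * (h - r)))) holes].

Lemma strips_normal :
  Forall (fun '(al, be, _, nu) => (0 <= nu /\ sqn al be <= nu * nu)%BZ) strips.
Proof. by repeat constructor. Qed.

(** This is Cauchy-Schwarz: the linear form is the real part of [c] times the conjugate of the
    normal, and the modulus is multiplicative. *)
Lemma strip_variation (al be nu : Z) (c : C) (r : R) :
  (0 <= nu)%BZ -> (sqn al be <= nu * nu)%BZ -> Cmod c <= r ->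
  Rabs (IZR al * fst c + IZR be * snd c) <= IZR nu * r.
Proof.
move=> nu0 Hn Hc.
have -> : IZR al * fst c + IZR be * snd c = fst (gauss al (- be) * c)%C.
  by rewrite /gauss /Cmult; cbn [fst snd]; rewrite opp_IZR; ring.
apply: Rle_trans (Rabs_fst_le_Cmod _) _; rewrite Cmod_mult.
apply: Rmult_le_compat; try exact: Cmod_ge_0; last by [].
by apply: Cmod_gauss_le => //; move: Hn; rewrite /sqn; lia.
Qed.

Lemma ball_in_domain_sound (B : ball) (X : C) :
  ball_in_domain B -> in_ball X B -> domain X.
Proof.
case: B => a b r; rewrite /ball_in_domain /in_ball; cbn [re im rad].
move=> /andP[/List.forallb_forall Hs /List.forallb_forall Hh] HX; split.
- apply/Forall_forall => -[[[al be] ga] nu] Hin.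
  have /Z.leb_le /IZR_le := Hs _ Hin.
  have := proj1 (Forall_forall _ _) strips_normal _ Hin; cbn beta iota => -[n0 nn].
  rewrite plus_IZR mult_IZR abs_IZR plus_IZR !mult_IZR => H.
  have := strip_variation _ _ _ _ _ n0 nn HX.
  set d := (X - gauss a b)%C => Hd.
  have -> : IZR al * fst X + IZR be * snd X
    = (IZR al * IZR a + IZR be * IZR b) + (IZR al * fst d + IZR be * snd d).
    by rewrite /d /gauss /Cminus /Cplus /Copp; cbn [fst snd]; ring.
  by apply: Rle_trans (Rabs_triang _ _) _; lra.
- apply/Forall_forall => -[[x y] h] Hin.
  have /andP[/Z.leb_le H1 /Z.leb_le H2] := Hh _ Hin.
  have := le_Cmod_gauss _ _ _ H1; have := le_Cmod_gauss _ _ _ H2.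
  rewrite -gauss_sub -gauss_add plus_IZR => G2 G1.
  have T1 := Cmod_triangle (X - gauss x y) (- (X - gauss a b)).
  have T2 := Cmod_triangle (X + gauss x y) (- (X - gauss a b)).
  rewrite Cmod_opp (_ : (X - gauss x y + - (X - gauss a b)
    = gauss a b - gauss x y)%C) in T1; last by ring.
  rewrite Cmod_opp (_ : (X + gauss x y + - (X - gauss a b)
    = gauss a b + gauss x y)%C) in T2; last by ring.
  by split; lra.
Qed.

(** The strip and hole tests contradict [domain X]; the conclusion itself comes from the test on the
    imaginary part. *)
Lemma ball_outside_sound (B : ball) (X : C) :
  ball_outside B -> in_ball X B -> domain X -> snd X < 0.
Proof.
case: B => a b r; rewrite /ball_outside /in_ball; cbn [re im rad].
move=> H HX [/Forall_forall Ds /Forall_forall Dh]; case/or3P: H.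
- move=> /List.existsb_exists [[[[al be] ga] nu] [Hin /Z.ltb_lt /IZR_lt]].
  have := proj1 (Forall_forall _ _) strips_normal _ Hin; cbn beta iota => -[n0 nn].
  rewrite plus_IZR mult_IZR abs_IZR plus_IZR !mult_IZR => H.
  have := strip_variation _ _ _ _ _ n0 nn HX.
  have := Ds _ Hin; cbn beta iota.
  set d := (X - gauss a b)%C => HV Hd; exfalso.
  have E : IZR al * IZR a + IZR be * IZR b
    = (IZR al * fst X + IZR be * snd X) - (IZR al * fst d + IZR be * snd d).
    by rewrite /d /gauss /Cminus /Cplus /Copp; cbn [fst snd]; ring.
  move: H; rewrite E => H.
  by have := Rabs_triang (IZR al * fst X + IZR be * snd X) (- (IZR al * fst d + IZR be * snd d));
    rewrite Rabs_Ropp -/(Rminus _ _); lra.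
- move=> /Z.ltb_lt /IZR_lt; rewrite plus_IZR => H.
  have := Rabs_snd_le_Cmod (X - gauss a b).
  have := Rle_abs (snd (X - gauss a b)%C).
  have : snd (X - gauss a b)%C = snd X - IZR b by [].
  by lra.
- move=> /List.existsb_exists [[[x y] h] [Hin /andP[/Z.ltb_lt Hr Hd]]]; exfalso.
  have := Dh _ Hin; cbn beta iota => -[D1 D2].
  have hr0 : (0 <= h - r)%BZ by lia.
  case/orP: Hd => /Z.ltb_lt Hd; have := Cmod_gauss_lt _ _ _ hr0 Hd;
    rewrite minus_IZR -?gauss_sub -?gauss_add => G.
    have T1 := Cmod_triangle (X - gauss a b) (gauss a b - gauss x y).
    rewrite (_ : (X - gauss a b + (gauss a b - gauss x y) = X - gauss x y)%C) in T1; last by ring.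
    by lra.
  have T1 := Cmod_triangle (X - gauss a b) (gauss a b + gauss x y).
  rewrite (_ : (X - gauss a b + (gauss a b + gauss x y) = X + gauss x y)%C) in T1; last by ring.
  by lra.
Qed.

Lemma domain_opp (X : C) : domain X -> domain (- X).
Proof.
case=> /Forall_forall Hs /Forall_forall Hh; split; apply/Forall_forall.
- move=> [[[al be] ga] nu] /Hs.
  rewrite /Copp; cbn [fst snd] => H.
  by rewrite -Rabs_Ropp (_ : - _ = IZR al * fst X + IZR be * snd X) //; ring.
- move=> [[x y] h] /Hh [H1 H2].
  rewrite -(Cmod_opp (- X - _)) -(Cmod_opp (- X + _)).
  rewrite (_ : (- (- X - gauss x y) = X + gauss x y)%C); last by ring.
  by rewrite (_ : (- (- X + gauss x y) = X - gauss x y)%C) //; ring.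
Qed.

(* [Go p] certifies a square by the word [p]; [Skip] marks a square not meeting the upper half
   of [domain]. *)
Inductive qtree := Skip | Go (p : positive) | Cut (a b c d : qtree).

(* [46341 / 2^15] slightly exceeds [sqrt 2]. *)
Definition circumradius (s : Z) : Z := (Z.shiftr (s * 46341) 15 + 1)%BZ.

Lemma circumradius_sound (s : Z) (c : C) :
  Rabs (fst c) <= IZR s -> Rabs (snd c) <= IZR s -> Cmod c <= IZR (circumradius s).
Proof.
move=> H1 H2.
have s0 : 0 <= IZR s by apply: Rle_trans H1; exact: Rabs_pos.
have Hc : Cmod c <= 46341 / 32768 * IZR s.
  rewrite /Cmod; apply: Rle_trans (sqrt_le_1_alt _ ((46341 / 32768 * IZR s) ^ 2) _) _.
    by move: (proj1 (Rabs_le_between _ _) H1) (proj1 (Rabs_le_between _ _) H2) => [? ?] [? ?]; nra.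
  by rewrite sqrt_pow2; nra.
apply: Rle_trans Hc _; rewrite /circumradius plus_IZR Z.shiftr_div_pow2 //.
rewrite (_ : (2 ^ 15 = 32768)%BZ) //.
have Hm := Z_div_mod_eq_full (s * 46341) 32768.
have [_ Hl] := Z.mod_pos_bound (s * 46341) 32768 ltac:(by []).
have : (s * 46341 <= 32768 * (s * 46341 / 32768 + 1))%BZ by lia.
by move=> /IZR_le; rewrite !mult_IZR plus_IZR; lra.
Qed.

(** The empty word [xH] is refused, since it would certify any square inside [domain] without making
    a move. The evenness test on [s] ensures that the four quarters fill the square. *)
Fixpoint covers (t : qtree) (a b s : Z) : bool :=
  match t with
  | Skip => ball_outside (Ball a b (circumradius s))
  | Go p => negb (Pos.eqb p xH) && ball_in_domain
      (ball_pull_word centre_re centre_im half_diag p (Ball a b (circumradius s)))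
  | Cut t1 t2 t3 t4 =>
      let h := Z.div2 s in
      [&& Z.eqb (2 * h) s, covers t1 (a - h) (b - h) h, covers t2 (a + h) (b - h) h,
          covers t3 (a - h) (b + h) h & covers t4 (a + h) (b + h) h]
  end.

(** Both bounds are triangle inequalities around the centre. The second one is [admissible w]
    written out; its worst case is the smallest modulus in the disc. *)
Lemma centre_bounds (w : C) : Cmod (scaled w - gauss centre_re centre_im) <= IZR half_diag ->
  Cmod (scaled w) <= IZR kappa /\
  IZR bound * IZR scale <= (IZR bound - IZR scale) * Cmod (scaled w).
Proof.
move=> Hw.
have T1 := Cmod_triangle (scaled w - gauss centre_re centre_im) (gauss centre_re centre_im).
have T2 := Cmod_triangle (- (scaled w - gauss centre_re centre_im)) (scaled w).
rewrite (_ : (scaled w - gauss centre_re centre_im + gauss centre_re centre_im = scaled w)%C)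
  in T1; last by ring.
rewrite Cmod_opp (_ : (- (scaled w - gauss centre_re centre_im) + scaled w
  = gauss centre_re centre_im)%C) in T2; last by ring.
have U : Cmod (gauss centre_re centre_im) <= IZR (kappa - half_diag).
  by apply: Cmod_gauss_le; vm_compute.
(* This integer and [kappa - half_diag] are consecutive and enclose the modulus of the centre. *)
have L : IZR 1459123419559 <= Cmod (gauss centre_re centre_im).
  by apply: le_Cmod_gauss; vm_compute.
rewrite minus_IZR in U; split; first by lra.
have : IZR (1459123419559 - half_diag) <= Cmod (scaled w) by rewrite minus_IZR; lra.
have : IZR (bound * scale) <= IZR ((bound - scale) * (1459123419559 - half_diag)).
  by apply: IZR_le; vm_compute.
have : 0 <= IZR (bound - scale) by apply: IZR_le; vm_compute.
rewrite !mult_IZR !minus_IZR => H0 H1 H2.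
by apply: Rle_trans H1 _; apply: Rmult_le_compat_l.
Qed.

Lemma covers_sound (w : C) (t : qtree) (a b s : Z) (X : C) :
  Cmod (scaled w - gauss centre_re centre_im) <= IZR half_diag -> covers t a b s ->
  domain X -> 0 <= snd X -> Rabs (fst X - IZR a) <= IZR s -> Rabs (snd X - IZR b) <= IZR s ->
  exists p, p <> xH /\ domain (pull_word w p X).
Proof.
move=> Hw; have [Hk _] := centre_bounds _ Hw.
elim: t a b s => [|p|t1 IH1 t2 IH2 t3 IH3 t4 IH4] a b s; cbn [covers] => H DX X0 Ha Hb.
- have HX : in_ball X (Ball a b (circumradius s)).
    by apply: circumradius_sound; rewrite /gauss /Cminus /Cplus /Copp; cbn [fst snd re im].
  by have := ball_outside_sound _ _ H HX DX; lra.
- have HX : in_ball X (Ball a b (circumradius s)).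
    by apply: circumradius_sound; rewrite /gauss /Cminus /Cplus /Copp; cbn [fst snd re im].
  move: H => /andP[/negP Hp HB]; exists p; split.
    by move=> E; apply: Hp; rewrite E.
  apply: ball_in_domain_sound HB _; exact: ball_pull_word_sound.
- move: H => /and5P[/Z.eqb_eq E H1 H2 H3 H4].
  have Es : IZR s = 2 * IZR (Z.div2 s) by rewrite -{1}E mult_IZR.
  set h := Z.div2 s in Es H1 H2 H3 H4.
  rewrite Es in Ha Hb.
  have [Ha1 Ha2] := proj1 (Rabs_le_between _ _) Ha; have [Hb1 Hb2] := proj1 (Rabs_le_between _ _) Hb.
  case: (Rle_lt_dec (fst X) (IZR a)) => Ca; case: (Rle_lt_dec (snd X) (IZR b)) => Cb.
  + by apply: IH1 H1 _ _ _ _ => //; rewrite minus_IZR; apply: Rabs_le; lra.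
  + by apply: IH3 H3 _ _ _ _ => //; rewrite ?minus_IZR ?plus_IZR; apply: Rabs_le; lra.
  + by apply: IH2 H2 _ _ _ _ => //; rewrite ?minus_IZR ?plus_IZR; apply: Rabs_le; lra.
  + by apply: IH4 H4 _ _ _ _ => //; rewrite plus_IZR; apply: Rabs_le; lra.
Qed.

(** The quarters come in the order lower left, lower right, upper left, upper right. Squares whose
    upper side lies on the real axis may need words too, because their circumscribed discs always
    cross the axis. *)
Definition cover_tree : qtree :=
  Cut (Cut Skip Skip (Cut Skip Skip Skip (Cut Skip Skip Skip (Cut Skip Skip Skip (Cut Skip Skip
  Skip (Cut Skip Skip Skip Skip))))) (Cut Skip Skip (Cut Skip Skip (Cut Skip Skip (Cut Skip
  Skip (Cut Skip Skip (Cut Skip Skip (Cut Skip Skip Skip (Cut Skip Skip Skip (Go 2))) (Go 2))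
  (Go 2)) (Go 2)) (Go 2)) (Go 2)) (Cut Skip Skip (Cut Skip Skip (Go 6) (Cut Skip Skip (Go 6)
  (Go 6))) (Cut Skip Skip (Cut Skip Skip (Go 6) (Go 6)) (Cut Skip Skip (Cut Skip Skip (Go 906)
  (Cut Skip Skip (Go 394) (Go 394))) (Cut Skip Skip (Go 906) (Cut Skip Skip (Cut Skip Skip (Go
  906) (Cut Skip Skip (Cut Skip Skip (Cut Skip Skip (Go 394) (Go 1033333)) (Go 1033333)) (Go
  394))) (Cut Skip Skip (Go 31626) (Cut Skip Skip (Go 31626) Skip))))))))) (Cut Skip Skip (Cut
  Skip Skip (Cut Skip Skip (Cut Skip Skip (Cut Skip Skip (Cut Skip Skip (Cut Skip Skip (Cut
  Skip Skip (Cut Skip Skip Skip (Cut Skip Skip (Cut Skip Skip Skip (Go 17525)) (Go 17525)))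
  (Cut Skip Skip (Go 17525) (Go 373))) (Cut Skip Skip (Cut Skip Skip (Go 373) (Go 17525)) (Go
  373))) (Go 373)) (Cut Skip Skip (Go 373) (Go 5))) (Go 5)) (Go 5)) (Cut Skip Skip (Go 3) (Cut
  Skip Skip (Go 3) (Cut Skip Skip (Go 3) (Cut Skip Skip (Go 3) (Cut Skip Skip (Go 3) Skip))))))
  (Cut Skip Skip (Cut Skip Skip (Cut Skip Skip Skip Skip) Skip) Skip)) (Cut (Cut Skip (Cut Skip
  (Cut Skip Skip Skip Skip) Skip Skip) Skip Skip) (Cut (Cut (Cut (Cut (Cut (Cut Skip (Go 2)
  Skip (Go 2)) (Go 2) (Go 2) (Go 2)) (Go 2) (Go 2) (Go 2)) (Go 2) (Go 2) (Go 2)) (Go 2) (Go 2)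
  (Go 2)) (Cut (Go 6) (Cut (Go 6) (Cut (Cut (Go 6) (Go 394) (Go 6) (Go 394)) (Cut (Go 394) (Cut
  (Cut (Go 394) (Cut (Go 31626) (Go 394) (Go 394) (Go 394)) (Go 394) (Go 394)) (Cut (Cut (Go
  394) (Go 31626) (Go 394) (Cut (Go 394) Skip (Go 394) (Go 394))) (Cut (Cut (Go 31626) (Cut (Go
  31626) Skip Skip Skip) Skip Skip) Skip Skip Skip) (Go 394) (Cut (Cut Skip Skip (Go 394) (Go
  50293)) (Cut Skip (Go 50293) (Go 50293) (Go 50293)) (Go 115829) (Go 50293))) (Go 394) (Cut
  (Go 394) (Cut (Go 394) (Go 115829) (Go 394) (Go 629)) (Go 394) (Cut (Go 40330) (Go 629) (Go
  629) (Go 629)))) (Go 394) (Cut (Go 394) (Cut (Go 394) (Go 629) (Go 7562) (Cut (Go 23946) (Go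
  629) (Go 15754) (Cut (Go 23946) (Go 629) (Go 629) (Go 629)))) (Go 394) (Cut (Go 1141) (Go
  629) (Go 1141) (Go 1141)))) (Go 74) (Cut (Go 138) (Go 1141) (Go 138) (Go 138))) (Go 6) (Cut
  (Go 6) (Cut (Go 138) (Go 138) (Go 138) (Go 138)) (Go 6) (Cut (Cut (Cut (Go 6) (Go 6) (Go 6)
  (Go 6)) (Cut (Cut (Go 6) (Go 6) (Cut (Go 6) (Go 138) (Go 138) (Cut (Go 138) (Go 138) (Go 138)
  (Go 47754))) (Cut (Go 138) (Go 6) (Cut (Go 138) (Go 138) (Go 2243210) (Go 138)) (Go 138)))
  (Go 6) (Cut (Cut (Go 138) (Cut (Go 138) (Cut (Go 47754) (Cut (Go 47754) (Cut (Go 47754) (Go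
  2243210) (Go 47754) (Go 2243210)) (Go 128072330) (Go 128072330)) (Cut (Go 47754) (Go 47754)
  (Go 47754) (Go 4318118)) (Cut (Cut (Go 47754) (Go 284998282) (Go 152945930) (Go 411165606))
  (Cut (Cut (Go 128072330) (Go 128072330) (Go 284998282) (Go 128072330)) (Go 128072330) (Go
  553433738) (Go 255981685)) (Cut (Go 287163658) (Go 411165606) (Go 4318118) (Go 142730150))
  (Cut (Cut (Go 287163658) (Cut (Go 1011292006) (Go 1011292006) (Go 553433738) (Go 1011292006))
  (Go 287163658) (Cut (Cut (Go 287163658) (Go 1011292006) (Go 287163658) (Go 1011292006)) (Go
  1011292006) (Go 1548162918) (Go 142730150))) (Go 1011292006) (Go 142730150) (Go 474421094))))
  (Go 138) (Cut (Go 4318118) (Cut (Cut (Go 4318118) (Go 6145290) (Go 4318118) (Go 4318118)) (Go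
  6145290) (Go 2561894) (Go 2561894)) (Go 138) (Go 2561894))) (Go 138) (Go 138)) (Cut (Cut (Cut
  (Cut (Go 2243210) (Go 2243210) (Cut (Go 128072330) (Go 2243210) (Go 128072330) (Go 4323445))
  (Go 4323445)) (Go 2243210) (Cut (Cut (Cut (Go 128072330) (Go 128072330) (Go 128072330) (Go
  255981685)) (Go 4323445) (Go 255981685) (Go 255981685)) (Go 4323445) (Cut (Cut (Go 255981685)
  (Go 255981685) (Go 474421094) (Go 255981685)) (Go 390199413) (Go 474421094) (Go 390199413))
  (Cut (Go 4323445) (Go 4323445) (Cut (Go 121763957) (Go 4323445) (Go 2220966) (Go 2220966))
  (Go 4323445))) (Go 4323445)) (Go 4323445) (Cut (Cut (Cut (Go 6145290) (Go 2220966) (Go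
  2220966) (Go 2220966)) (Go 2220966) (Go 2220966) (Go 2220966)) (Cut (Go 4323445) (Go 4323445)
  (Go 2220966) (Go 2220966)) (Go 2561894) (Go 2220966)) (Cut (Cut (Cut (Go 4323445) (Go
  1513318) (Go 1513318) (Go 1513318)) (Go 1513318) (Go 1513318) (Go 1513318)) (Go 1513318) (Go
  2220966) (Go 1513318))) (Cut (Go 2226293) (Go 138) (Go 1513318) (Go 138)) (Cut (Go 2561894)
  (Go 1513318) (Go 138) (Go 138)) (Go 1172390)) (Go 138) (Go 138)) (Go 6)) (Go 6) (Go 6)) (Go
  138) (Go 6) (Go 138)))) (Cut (Go 6) (Go 6) (Cut (Go 2) (Cut (Go 2) (Go 6) (Go 2) (Cut (Go 6)
  (Go 6) (Cut (Go 2) (Go 6) (Go 6) (Go 4605)) (Cut (Go 6) (Go 6) (Cut (Go 4605) (Go 4605) (Go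
  4605) (Go 4605)) (Cut (Go 6) (Go 6) (Cut (Go 4605) (Go 4605) (Go 4605) (Go 4605)) (Go
  2557))))) (Go 2) (Cut (Go 6) (Cut (Cut (Go 6) (Go 4605) (Go 6) (Go 6)) (Go 4605) (Go 6) (Go
  6)) (Go 6) (Go 6))) (Cut (Go 6) (Go 6) (Go 6) (Go 6))) (Cut (Go 6) (Cut (Go 6) (Go 138) (Go
  6) (Go 6)) (Go 6) (Go 6))) (Cut Skip (Cut (Go 2) (Go 6) Skip (Go 6)) Skip Skip) (Cut (Go 6)
  (Cut (Go 6) (Go 6) (Go 6) (Go 14)) (Cut Skip (Go 6) Skip Skip) (Cut (Go 6) (Go 14) Skip
  Skip))) Skip Skip) (Cut (Cut (Cut (Cut (Cut (Cut (Cut (Cut (Cut Skip (Go 17525) (Cut (Go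
  990602) (Go 990602) (Go 50293) (Go 50293)) (Cut (Go 990602) (Go 17525) (Go 17525) (Go
  17525))) (Go 17525) (Cut (Go 50293) (Go 50293) (Go 50293) (Go 9333)) (Go 9333)) (Cut (Cut (Go
  373) (Cut (Go 539530) (Cut (Go 539530) (Go 373) (Go 539530) (Go 629)) (Go 629) (Go 17525))
  (Go 629) (Go 373)) (Go 629) (Go 629) (Go 373)) (Go 629) (Go 629)) (Go 629) (Cut (Go 629) (Go
  629) (Go 629) (Go 629)) (Go 629)) (Cut (Cut (Go 373) (Go 373) (Cut (Go 373) (Go 373) (Go 629)
  (Go 629)) (Go 629)) (Go 629) (Cut (Go 4550) (Go 629) (Go 629) (Go 629)) (Cut (Go 629) (Go 5)
  (Go 629) (Cut (Go 5) (Go 5) (Go 629) (Go 5)))) (Cut (Cut (Go 1141) (Go 629) (Go 138) (Go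
  1141)) (Cut (Go 629) (Go 629) (Go 1141) (Go 629)) (Cut (Go 138) (Go 1141) (Go 138) (Go 138))
  (Cut (Go 1141) (Go 1141) (Go 7818) (Cut (Go 1141) (Cut (Go 1141) (Cut (Go 1141) (Cut (Go
  1141) (Cut (Go 1141) (Go 3189) (Go 1141) (Cut (Go 3189) (Cut (Go 3189) (Go 126069) (Go
  126069) (Go 4660874)) (Go 3189) (Cut (Go 126316998) (Cut (Go 126316998) (Go 4660874) (Go
  126316998) (Go 4660874)) (Go 126316998) (Go 126316998)))) (Go 1141) (Cut (Go 1141) (Go
  126069) (Go 1141) (Go 1141))) (Go 1141) (Go 1141)) (Go 1141) (Go 1141)) (Go 7818) (Cut (Go
  1141) (Go 142986) (Go 7818) (Go 40586))))) (Cut (Cut (Go 629) (Go 629) (Go 629) (Go 3189))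
  (Cut (Go 2502) (Cut (Go 629) (Go 1478) (Go 2502) (Go 1478)) (Go 2502) (Cut (Go 7285) (Go
  2502) (Go 2502) (Go 2502))) (Cut (Go 3189) (Go 3189) (Cut (Cut (Cut (Cut (Cut (Go 126069) (Go
  1141) (Cut (Go 4660874) (Go 126069) (Cut (Go 4660874) (Go 4660874) (Go 126316998) (Go
  126069)) (Go 126069)) (Go 3189)) (Go 1141) (Go 126069) (Go 1141)) (Go 1141) (Go 1141) (Go
  3189)) (Go 3189) (Go 126069) (Go 126069)) (Go 29126) (Cut (Go 40586) (Go 40586) (Go 61894)
  (Go 61894)) (Go 40586)) (Cut (Go 3189) (Go 9994) (Go 29126) (Go 9994))) (Cut (Go 9994) (Go
  2502) (Cut (Go 7285) (Go 7285) (Go 7285) (Go 7285)) (Go 7285)))) (Cut (Go 5) (Go 5) (Cut (Cut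
  (Go 1478) (Go 5) (Go 1478) (Go 1478)) (Go 5) (Cut (Go 2502) (Go 454) (Cut (Go 2502) (Go 454)
  (Go 15477) (Go 454)) (Go 454)) (Go 454)) (Cut (Go 5) (Go 5) (Go 493) (Go 493))) (Cut (Cut (Go
  138) (Cut (Cut (Cut (Go 138) (Go 138) (Go 138) (Go 62581)) (Go 7818) (Cut (Go 138) (Cut (Go
  3722) (Cut (Go 62581) (Cut (Go 7818) (Go 7818) (Go 62581) (Cut (Go 62581) (Go 7818) (Go
  62581) (Cut (Go 7818) (Go 138) (Go 62581) (Go 138)))) (Cut (Go 7818) (Go 7435381) (Go 138)
  (Go 7818)) (Cut (Go 7435381) (Go 63146762) (Go 7818) (Go 138))) (Go 138) (Go 7818)) (Go 138)
  (Go 138)) (Cut (Cut (Cut (Go 138) (Go 138) (Go 138) (Go 138)) (Go 138) (Go 138) (Go 138)) (Go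
  7818) (Go 138) (Go 1802))) (Cut (Go 7818) (Cut (Go 7818) (Go 24202) (Go 7818) (Go 7818)) (Go
  7818) (Go 1802)) (Go 138) (Go 1802)) (Go 138) (Cut (Go 138) (Go 1802) (Go 138) (Go 778)))
  (Cut (Cut (Cut (Go 61894) (Cut (Go 35594) (Go 61894) (Go 24202) (Go 61894)) (Go 1802) (Go
  1802)) (Cut (Go 35594) (Go 9994) (Go 1802) (Go 1802)) (Go 1802) (Go 1802)) (Cut (Go 5898)
  (Cut (Go 7285) (Go 5898) (Go 1802) (Go 3850)) (Go 1802) (Go 1802)) (Cut (Go 1802) (Go 1958)
  (Go 778) (Go 1958)) (Cut (Go 1958) (Go 1958) (Go 1958) (Go 1958))) (Cut (Go 138) (Go 778) (Go
  38) (Go 38)) (Cut (Go 934) (Cut (Go 38) (Go 1802) (Go 38) (Go 38)) (Go 38) (Go 38))) (Cut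
  (Cut (Cut (Cut (Go 15477) (Go 3850) (Go 3850) (Go 454)) (Go 454) (Go 3850) (Go 454)) (Go 454)
  (Cut (Go 454) (Go 454) (Go 454) (Go 454)) (Go 454)) (Cut (Go 493) (Go 198) (Go 198) (Go 237))
  (Cut (Go 38) (Go 38) (Go 38) (Go 38)) (Go 198))) (Cut (Cut (Go 5) (Go 5) (Cut (Go 454) (Go 5)
  (Cut (Go 454) (Go 5) (Go 5) (Go 5)) (Go 5)) (Go 5)) (Go 5) (Go 13) (Go 13)) (Cut (Go 38) (Cut
  (Go 38) (Go 38) (Cut (Go 38) (Go 38) (Go 38) (Cut (Go 38) (Cut (Go 38) (Go 38) (Cut (Go 38)
  (Go 38) (Cut (Go 38) (Go 38) (Go 1609382) (Go 293101)) (Go 38)) (Go 38)) (Cut (Go 38) (Cut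
  (Go 38) (Cut (Go 38) (Cut (Go 38) (Go 38) (Go 38) (Go 560806)) (Go 38) (Cut (Go 560806) (Cut
  (Go 560806) (Go 560806) (Go 560806) (Go 36118026)) (Cut (Go 38) (Go 560806) (Go 38) (Go
  11942)) (Cut (Go 560806) (Go 1515018) (Go 1515018) (Go 1515018)))) (Go 38) (Cut (Go 38) (Cut
  (Go 11942) (Go 1515018) (Go 38) (Go 11942)) (Go 38) (Go 38))) (Go 22) (Go 38)) (Cut (Cut (Cut
  (Cut (Cut (Go 38) (Go 1609382) (Go 38) (Go 1609382)) (Cut (Go 1609382) (Go 378333) (Go
  990730) (Go 378333)) (Cut (Go 31699270) (Go 990730) (Go 990730) (Go 990730)) (Go 990730)) (Go
  378333) (Cut (Cut (Go 990730) (Go 990730) (Cut (Go 82349734) (Go 990730) (Go 48795302) (Go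
  36118026)) (Go 990730)) (Go 990730) (Cut (Cut (Go 990730) (Go 990730) (Go 990730) (Go
  990730)) (Go 990730) (Go 1515018) (Go 990730)) (Go 555245)) (Go 555245)) (Cut (Go 12614) (Go
  38) (Go 38) (Go 38)) (Cut (Cut (Go 1515018) (Go 466442) (Go 466442) (Go 38)) (Go 38) (Go 38)
  (Go 38)) (Go 38)) (Go 38) (Go 38) (Go 38)))) (Go 38)) (Go 22) (Cut (Go 38) (Go 38) (Go 22)
  (Go 29))) (Cut (Cut (Go 13) (Go 13) (Go 38) (Go 13)) (Go 13) (Cut (Go 38) (Go 13) (Go 29) (Go
  29)) (Cut (Go 13) (Go 13) (Go 29) (Go 70)))) (Cut (Go 3) (Cut (Go 3) (Cut (Go 3) (Cut (Go 3)
  (Cut (Go 3) (Cut (Cut (Go 3) Skip (Go 3) Skip) Skip (Go 3) Skip) (Go 3) (Go 3)) (Go 3) (Go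
  3)) (Go 3) (Go 3)) (Go 3) (Go 3)) (Cut (Go 13) (Go 3) (Go 29) (Cut (Go 13) (Go 3) (Go 29) (Go
  29))) (Cut (Go 3) (Go 3) (Cut (Go 3) (Go 3) (Go 3) (Go 3)) (Go 3))) (Cut (Cut (Go 22) (Cut
  (Go 22) (Go 29) (Go 22) (Go 29)) (Go 61) (Cut (Go 61) (Go 29) (Cut (Go 61) (Go 61) (Go 14)
  (Go 61)) (Cut (Cut (Go 61) (Go 29) (Cut (Go 61) (Cut (Go 61) (Go 61) (Cut (Go 61) Skip (Go
  61) Skip) Skip) (Go 61) (Cut (Cut (Go 61) (Go 408102) (Go 61) (Go 493334)) (Cut Skip Skip
  (Cut Skip Skip (Go 61) (Go 61)) (Go 61)) (Go 61) (Go 61))) (Cut (Cut (Go 61) (Go 29) (Cut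
  Skip (Go 61) Skip (Go 61)) (Go 61)) (Go 61) (Go 61) (Go 61))) (Go 61) (Cut (Go 61) (Go 61)
  (Go 61) (Go 61)) (Go 61)))) (Cut (Go 29) (Cut (Go 29) (Cut (Cut (Go 70) (Go 70) (Go 29) (Go
  29)) (Go 29) (Go 29) (Go 29)) (Go 29) (Go 29)) (Go 61) (Cut (Go 29) (Go 29) (Go 29) (Go 29)))
  (Cut (Go 14) (Cut (Go 61) (Go 61) Skip Skip) Skip Skip) (Cut (Cut (Go 61) (Go 61) Skip Skip)
  (Cut (Go 93) (Go 93) Skip Skip) Skip Skip)) (Cut (Cut (Go 29) (Cut (Go 29) (Go 29) (Go 29)
  (Cut (Go 29) (Go 123) (Go 379) (Go 123))) (Cut (Go 29) (Cut (Go 29) (Go 29) (Go 29) (Go 557))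
  (Go 93) (Go 157)) (Cut (Cut (Go 1542) (Go 557) (Go 635) (Go 557)) (Cut (Cut (Go 379) (Go 379)
  (Go 557) (Go 635)) (Go 635) (Go 635) (Cut (Go 635) (Go 635) (Cut (Go 635) (Go 635) (Go 635)
  (Cut (Go 635) (Go 635) (Go 635) (Go 28859))) (Cut (Go 635) (Go 14971) (Go 28859) (Go
  31355)))) (Cut (Go 157) (Cut (Go 635) (Go 635) (Go 1147) (Go 3195)) (Go 157) (Cut (Go 157)
  (Cut (Go 1147) (Go 3195) (Go 7213) (Go 7837)) (Go 157) (Cut (Go 7213) (Go 7837) (Go 157)
  Skip))) (Cut (Cut (Go 635) (Go 635) (Go 3195) (Go 3195)) (Cut (Cut (Go 635) (Go 31355) (Go
  7291) (Go 7291)) (Cut (Go 31355) (Cut (Go 31355) (Go 31355) (Go 10013) (Go 10013)) (Go 10013)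
  (Go 10013)) (Go 7291) (Cut (Cut (Go 7291) (Go 7291) (Go 7291) (Go 7291)) (Go 10013) (Go 7291)
  Skip)) (Cut (Go 3195) (Go 3195) (Go 1821) Skip) (Cut (Cut (Go 10013) (Go 10013) Skip Skip)
  Skip Skip Skip)))) (Cut (Cut (Cut (Go 123) (Cut (Go 3) (Go 3) (Go 3) (Cut (Go 3) (Cut (Go 3)
  (Go 3) (Go 3) (Cut (Go 3) Skip Skip Skip)) (Go 3) (Cut (Go 3) (Cut Skip Skip (Go 3) Skip) (Go
  3) (Go 3)))) (Go 123) (Go 123)) (Cut (Cut (Go 3) (Go 3) (Cut (Cut (Go 123) (Go 3) Skip (Go
  123)) (Go 3) (Cut Skip (Go 123) (Go 123) (Go 3)) (Go 3)) (Go 3)) (Go 3) (Go 3) (Go 3)) (Go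
  123) (Go 123)) (Cut (Go 3) (Go 3) (Go 123) Skip) (Cut (Cut (Cut (Go 123) (Go 123) (Go 2235)
  (Cut (Go 123) (Go 123) (Go 7686) (Go 15878))) (Go 123) (Cut (Go 2235) (Cut (Go 2235) (Go
  2235) (Go 2235) (Go 2235)) (Cut (Go 12475) (Go 2235) (Go 28859) (Go 15878)) (Cut (Go 2235)
  (Go 2235) (Go 15878) Skip)) (Cut (Go 2235) Skip Skip Skip)) (Cut (Go 123) Skip Skip Skip)
  (Cut (Cut (Cut (Cut (Go 28859) (Go 15878) (Go 10013) (Go 32262)) (Cut (Go 15878) (Go 15878)
  (Go 32262) Skip) (Go 32262) Skip) Skip Skip Skip) Skip Skip Skip) Skip) Skip) (Cut (Cut (Go
  93) (Cut (Go 157) (Go 157) Skip Skip) Skip Skip) (Cut (Go 157) Skip Skip Skip) Skip Skip)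
  Skip)) (Cut (Cut (Cut (Cut (Cut Skip Skip (Go 3) Skip) Skip (Go 3) Skip) Skip (Go 3) Skip)
  Skip (Go 3) Skip) Skip Skip Skip) Skip Skip).

(** The root square contains [domain] by [domain_box], and its half side is a power of two, so that
    the repeated halvings are exact. *)
Lemma cover_tree_covers : covers cover_tree 0 0 (2 * scale).
Proof. by vm_compute. Qed.

End SelfCover.

(** * Survival on the boundary of the square and death inside *)

Inductive arc := Arc (hi : Z) (p : positive).

Section Arcs.
Import ListNotations.
Local Open Scope Z_scope.

(** Offsets are measured along a side from its midpoint, in increasing order. The words in the four
    lists have from 36 to 56 moves. *)
Definition bottom_arcs : list arc :=
  [Arc (-5463198) 133391926389; Arc (-5281092) 133391926389; Arc (-5098985) 153652702954613;
  Arc (-4916879) 8517168088181; Arc (-4734772) 8517168088181; Arc (-4370559) 8517168088181; Arc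
  (-4006346) 8517168088181; Arc (-3824240) 8517168088181; Arc (-3733187) 8517168088181; Arc
  (-3642133) 8517168088181; Arc (-3460027) 8517168088181; Arc (-3277920) 8517168088181; Arc
  (-2913706) 12915214599285; Arc (-2185280) 12915214599285; Arc (-1456853) 12915214599285; Arc
  (-1092640) 270830879861; Arc (-728427) 270830879861; Arc 0 270830879861; Arc 728426
  270830879861; Arc 1092639 270830879861; Arc 1456852 17038383203445; Arc 2185278
  17038383203445; Arc 2913705 545708786805; Arc 5827411 545708786805].

Definition top_arcs : list arc :=
  [Arc (-5098985) 15651363152501; Arc (-4370559) 15651363152501; Arc (-4006346) 6855270130293;
  Arc (-3642133) 6855270130293; Arc (-2913706) 6855270130293; Arc (-2549493) 6855270130293; Arc
  (-2367387) 6855270130293; Arc (-2185280) 87956883194997; Arc (-1821067) 2457223619189; Arc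
  (-1456853) 2457223619189; Arc (-728427) 2457223619189; Arc 0 2457223619189; Arc 728426
  2457223619189; Arc 1456852 2457223619189; Arc 2185278 2457223619189; Arc 2913705
  4656246874741; Arc 4370558 4393999484021; Arc 5098984 4393999484021; Arc 5463197
  4393999484021; Arc 5827411 4393999484021].

Definition left_arcs : list arc :=
  [Arc (-5463198) 133391926389; Arc (-5281092) 133391926389; Arc (-5098985) 133391926389; Arc
  (-4916879) 501098377331829; Arc (-4734772) 688152793007221; Arc (-4552666) 125202839585909;
  Arc (-4370559) 125202839585909; Arc (-4188453) 125202839585909; Arc (-4006346)
  125202839585909; Arc (-3642133) 54834095408245; Arc (-3277920) 54834095408245; Arc (-3095813)
  54834095408245; Arc (-2913706) 19649723319413; Arc (-2549493) 19649723319413; Arc (-2185280)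
  19649723319413; Arc (-1821067) 19649723319413; Arc (-1456853) 19649723319413; Arc (-1092640)
  19649723319413; Arc (-728427) 107610653541493; Arc (-546321) 37241909363829; Arc (-364214)
  37241909363829; Arc (-182107) 37241909363829; Arc (-91054) 37241909363829; Arc 0
  2148304234693749; Arc 91053 2148304234693749; Arc 182106 2148304234693749; Arc 273159
  494638746518645; Arc 364213 494638746518645; Arc 546319 494638746518645; Arc 728426
  494638746518645; Arc 910532 494638746518645; Arc 1092639 1057588699939957; Arc 1183692
  1057588699939957; Arc 1274745 1057588699939957; Arc 1365798 2183488606782581; Arc 1456852
  2183488606782581; Arc 1502378 2183488606782581; Arc 1547905 4435288420467829; Arc 1638958
  4435288420467829; Arc 1661721 4435288420467829; Arc 1684484 78744682272081013; Arc 1730011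
  22449686929949813; Arc 1752774 22449686929949813; Arc 1775538 22449686929949813; Arc 1798301
  22449686929949813; Arc 1821065 40464085439431797; Arc 1843828 40464085439431797; Arc 1855209
  349902897996405; Arc 1866591 349902897996405; Arc 1912118 349902897996405; Arc 2003171
  349902897996405; Arc 2094224 349902897996405; Arc 2185278 349902897996405; Arc 2367384
  209165409641077; Arc 2549491 209165409641077; Arc 2731598 68427921285749; Arc 2913705
  68427921285749; Arc 3277918 68427921285749; Arc 3642131 68427921285749; Arc 4370558
  33243549196917; Arc 4552664 33243549196917; Arc 4643717 33243549196917; Arc 4734771
  33243549196917; Arc 5098984 33243549196917; Arc 5463197 15651363152501; Arc 5827411
  15651363152501].

Definition right_arcs : list arc :=
  [Arc (-4370559) 545708786805; Arc (-3642133) 545708786805; Arc (-3277920) 545708786805; Arc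
  (-2913706) 545708786805; Arc (-2549493) 545708786805; Arc (-2185280) 1095464600693; Arc
  (-1456853) 1095464600693; Arc (-728427) 1095464600693; Arc 0 1095464600693; Arc 728426
  1095464600693; Arc 910532 1095464600693; Arc 1092639 1095464600693; Arc 1456852
  68165673895029; Arc 2185278 2194976228469; Arc 2913705 2194976228469; Arc 3642131
  2194976228469; Arc 4370558 2194976228469; Arc 5098984 2194976228469; Arc 5463197
  2194976228469; Arc 5827411 4393999484021].

End Arcs.

(** * Bounded orbits of 0: on the boundary of the square, and at one point inside *)

Section Survival.
Local Open Scope R_scope.

(** Only the last point is asked to lie in the disc: for admissible [w], [pull_bound] then puts all
    earlier ones there. *)
Fixpoint survives (w : C) (n : nat) (X : C) : Prop :=
  match n with
  | 0%N => Cmod X <= IZR bound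
  | m.+1 => exists e, survives w m (pull w e X)
  end.

(* Equivalent to [1 + B / |w| <= B] for the unscaled radius [B], so that the disc of that
   radius is mapped into itself by the forward maps [x |-> w^-1 x +- 1]. *)
Definition admissible (w : C) : Prop :=
  IZR bound * IZR scale <= (IZR bound - IZR scale) * Cmod (scaled w).

Lemma bound_gt_scale : 0 < IZR (bound - scale).
Proof. by apply: IZR_lt. Qed.

Lemma Cmod_scaled (w : C) : Cmod (scaled w) = IZR scale * Cmod w.
Proof.
rewrite /scaled Cmod_mult Cmod_R Rabs_pos_eq //.
by left; exact: scale_gt0.
Qed.

Lemma admissible_gt0 (w : C) : admissible w -> 0 < Cmod w.
Proof.
rewrite /admissible Cmod_scaled; have := scale_gt0; have := bound_gt_scale.
rewrite minus_IZR => H1 H2 H3.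
case: (Rle_lt_or_eq_dec _ _ (Cmod_ge_0 w)) => // E.
by move: H3; rewrite -E; nra.
Qed.

Lemma Cmod_digit (e : bool) : Cmod (RtoC (IZR (digit e))) = IZR scale.
Proof.
rewrite Cmod_R -abs_IZR; case: e => //.
Qed.

(** Escape is irreversible: going back one move divides by [w] and adds a digit of modulus [scale],
    which keeps the disc inside itself. *)
Lemma pull_bound (w : C) (e : bool) (X : C) : admissible w ->
  Cmod (pull w e X) <= IZR bound -> Cmod X <= IZR bound.
Proof.
move=> Hw; have w0 := admissible_gt0 _ Hw; move: Hw.
rewrite /admissible Cmod_scaled /pull Cmod_mult => Hw Hp.
have T := Cmod_triangle (X - RtoC (IZR (digit e))) (RtoC (IZR (digit e))).
rewrite Cmod_digit (_ : (X - IZR (digit e) + IZR (digit e) = X)%C) in T; last by ring.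
have S0 := scale_gt0.
have Hb : IZR bound <= (IZR bound - IZR scale) * Cmod w by nra.
have : Cmod (X - RtoC (IZR (digit e))) <= IZR bound - IZR scale.
  by apply: Rmult_le_reg_r w0 _; lra.
by lra.
Qed.

Lemma survives_bound (w : C) (n : nat) (X : C) : admissible w ->
  survives w n X -> Cmod X <= IZR bound.
Proof.
move=> Hw; elim: n X => [|n IH] X //= [e /IH]; exact: pull_bound.
Qed.

Lemma survivesW (w : C) (n : nat) (X : C) : admissible w ->
  survives w n.+1 X -> survives w n X.
Proof.
move=> Hw; elim: n X => [|n IH] X; first exact: survives_bound.
by case=> e /IH He; exists e.
Qed.

Lemma survives_pull_word (w : C) (n : nat) (p : positive) (X : C) : admissible w ->
  survives w n (pull_word w p X) -> survives w n X.
Proof.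
move=> Hw; elim: p X => [p IH|p IH|] X //= /IH He;
  by apply: survivesW => //; eexists; exact: He.
Qed.

(** The first move is counted and the others are absorbed by [survives_pull_word]. This gain of one
    unit drives the induction in [domain_survives]. *)
Lemma survives_nonempty_word (w : C) (n : nat) (p : positive) (X : C) : admissible w ->
  p <> xH -> survives w n (pull_word w p X) -> survives w n.+1 X.
Proof.
move=> Hw; case: p => [p|p|] //= _ /(survives_pull_word _ _ _ _ Hw) H.
  by exists true.
by exists false.
Qed.

(** Reversing every digit negates the whole orbit. *)
Lemma survives_opp (w : C) (n : nat) (X : C) : survives w n X -> survives w n (- X)%C.
Proof.
elim: n X => [|n IH] X /=; first by rewrite Cmod_opp.
case=> e /IH He; exists (negb e).
have Ed : RtoC (IZR (digit (negb e))) = (- RtoC (IZR (digit e)))%C.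
  by rewrite -RtoC_opp -opp_IZR; case: (e).
by rewrite /pull Ed (_ : ((- X - - _) * w)%C = (- pull w e X)%C) // /pull; ring.
Qed.

Lemma domain_box (X : C) : domain X ->
  Rabs (fst X) <= IZR (2 * scale) /\ Rabs (snd X) <= IZR scale.
Proof.
case=> /Forall_forall Hs _.
have H1 : Rabs (32 * fst X + 0 * snd X) <= 36433597988864 :=
  Hs (32, 0, 36433597988864, 32)%BZ ltac:(by left).
have H2 : Rabs (0 * fst X + 32 * snd X) <= 26642177163264 :=
  Hs (0, 32, 26642177163264, 32)%BZ ltac:(by do 4 right; left).
have [? ?] := proj1 (Rabs_le_between _ _) H1.
have [? ?] := proj1 (Rabs_le_between _ _) H2.
by rewrite mult_IZR /scale; split; apply: Rabs_le; lra.
Qed.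

(** [domain] lies in the disc, and the quadtree returns each of its points to it by a nonempty word,
    so the length of survival grows without end. *)
Lemma domain_survives (w : C) (n : nat) (X : C) :
  Cmod (scaled w - gauss centre_re centre_im) <= IZR half_diag ->
  domain X -> survives w n X.
Proof.
move=> Hw; have [_ Aw] := centre_bounds _ Hw.
elim: n X => [|n IH] X DX.
  have [H1 H2] := domain_box _ DX.
  apply: Rle_trans (Cmod_le_abs _) _.
  have : IZR (2 * scale + scale) <= IZR bound by apply: IZR_le.
  by rewrite plus_IZR; lra.
(* The quadtree certifies the upper half only; the central symmetry of [domain] and of survival
   supplies the rest. *)
wlog X0 : X DX / 0 <= snd X.
  move=> H; case: (Rle_lt_dec 0 (snd X)) => X0; first exact: H.
  rewrite (_ : X = (- - X)%C); last by ring.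
  apply: survives_opp; apply: H; first exact: domain_opp.
  by rewrite /Copp; cbn [fst snd]; lra.
have [H1 H2] := domain_box _ DX.
have B1 : Rabs (fst X - IZR 0) <= IZR (2 * scale) by rewrite Rminus_0_r.
have B2 : Rabs (snd X - IZR 0) <= IZR (2 * scale).
  by rewrite Rminus_0_r mult_IZR; have := scale_gt0; lra.
have [p [p1 /IH]] := covers_sound _ _ _ _ _ _ Hw cover_tree_covers DX X0 B1 B2.
exact: survives_nonempty_word.
Qed.

Definition side_point (horizontal : bool) (offset t : Z) : Z * Z :=
  if horizontal then (centre_re + t, centre_im + offset)%BZ
  else (centre_re + offset, centre_im + t)%BZ.

Definition on_side (horizontal : bool) (offset : Z) (t : R) (U : C) : Prop :=
  U = if horizontal then (IZR centre_re + t, IZR (centre_im + offset))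
      else (IZR (centre_re + offset), IZR centre_im + t).

(* An entry [Arc hi p] claims that the word [p] carries 0 into [domain] for all parameters
   between the end point of the previous arc and [hi]. *)
Fixpoint arcs_ok (horizontal : bool) (offset lo : Z) (l : list arc) : bool :=
  match l with
  | nil => Z.leb half_side lo
  | cons (Arc hi p) l' =>
      let m := Z.div2 (lo + hi) in
      let c := side_point horizontal offset m in
      ball_in_domain (ball_pull_word c.1 c.2 (hi - m) p (Ball 0 0 0)) &&
      arcs_ok horizontal offset hi l'
  end.

Lemma arcs_ok_sound (horizontal : bool) (offset lo : Z) (l : list arc)
    (t : R) (w : C) :
  arcs_ok horizontal offset lo l -> IZR lo < t <= IZR half_side ->
  on_side horizontal offset t (scaled w) -> Cmod (scaled w) <= IZR kappa ->
  exists p, domain (pull_word w p 0%C).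
Proof.
move=> + + Hs Hk; elim: l lo => [|[hi p] l IH] lo; cbn [arcs_ok].
  by move=> /Z.leb_le /IZR_le; lra.
set m := Z.div2 (lo + hi).
move=> /andP[Hd Hl] [lt1 lt2].
case: (Rle_lt_dec t (IZR hi)) => Ht; last exact: (IH hi).
exists p; apply: ball_in_domain_sound Hd _; apply: ball_pull_word_sound => //.
  (* The midpoint is rounded down, so [hi] is the farther end and [hi - m] bounds the distance from
     [m] to the whole arc. *)
  have Hm : (2 * m <= lo + hi)%BZ.
    by rewrite /m Z.div2_div; have := Z.mul_div_le (lo + hi) 2; lia.
  move: Hm => /IZR_le; rewrite (mult_IZR 2 m) (plus_IZR lo hi) => Hm.
  apply: Rle_trans (Cmod_le_abs _) _.
  rewrite Hs /side_point /gauss (minus_IZR hi m).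
  case: (horizontal); rewrite /Cminus /Cplus /Copp; cbn [fst snd].
    rewrite (plus_IZR centre_re m) Rplus_opp_r Rabs_R0 Rplus_0_r.
    rewrite (_ : IZR centre_re + t + - (IZR centre_re + IZR m) = t - IZR m); last by ring.
    by apply: Rabs_le; lra.
  rewrite (plus_IZR centre_im m) Rplus_opp_r Rabs_R0 Rplus_0_l.
  rewrite (_ : IZR centre_im + t + - (IZR centre_im + IZR m) = t - IZR m); last by ring.
  by apply: Rabs_le; lra.
rewrite /in_ball; cbn [re im rad].
by rewrite /gauss -/(RtoC 0) /Cminus Cplus_opp_r Cmod_0; right.
Qed.

Lemma arcs_certificate :
  [&& arcs_ok true (- half_side) (- half_side - 1) bottom_arcs,
      arcs_ok true half_side (- half_side - 1) top_arcs,
      arcs_ok false (- half_side) (- half_side - 1) left_arcs &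
      arcs_ok false half_side (- half_side - 1) right_arcs].
Proof. by vm_compute. Qed.

Lemma square_near (U : C) :
  Rmax (Rabs (fst U - IZR centre_re)) (Rabs (snd U - IZR centre_im)) <= IZR half_side ->
  Cmod (U - gauss centre_re centre_im) <= IZR half_diag.
Proof.
move=> HU; apply: Rle_trans (Cmod_2Rmax _) _.
apply: Rle_trans (Rmult_le_compat_l _ _ _ (sqrt_pos 2) HU) _.
have : sqrt 2 <= 1.4142136.
  by rewrite -(sqrt_pow2 1.4142136); [apply: sqrt_le_1_alt|]; lra.
by rewrite /half_side /half_diag; lra.
Qed.

(** The parameter lies on one of the four sides, where the word of some arc takes 0 into
    [domain]. *)
Lemma boundary_survives (w : C) (n : nat) :
  Rmax (Rabs (fst (scaled w) - IZR centre_re)) (Rabs (snd (scaled w) - IZR centre_im))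
    = IZR half_side ->
  survives w n 0%C.
Proof.
move=> Hmax.
have H1 := Rmax_l (Rabs (fst (scaled w) - IZR centre_re)) (Rabs (snd (scaled w) - IZR centre_im)).
have H2 := Rmax_r (Rabs (fst (scaled w) - IZR centre_re)) (Rabs (snd (scaled w) - IZR centre_im)).
rewrite Hmax in H1 H2.
have Hw : Cmod (scaled w - gauss centre_re centre_im) <= IZR half_diag.
  by apply: square_near; rewrite Hmax; exact: Rle_refl.
have [Hk Aw] := centre_bounds _ Hw.
suff [p Dp] : exists p, domain (pull_word w p 0%C).
  by apply: survives_pull_word Aw _; apply: domain_survives Hw Dp.
have [C1 C2 C3 C4] := and4P arcs_certificate.
(* Arcs are open on the left, so each list starts one unit before the corner in order to include
   it. *)
have Hlo : IZR (- half_side - 1) = - IZR half_side - 1 by rewrite minus_IZR opp_IZR.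
have [G1 G1'] := proj1 (Rabs_le_between _ _) H1.
have [G2 G2'] := proj1 (Rabs_le_between _ _) H2.
have Ew : scaled w = (fst (scaled w), snd (scaled w)) by case: (scaled w).
have Habs y : Rabs y = IZR half_side -> y = IZR half_side \/ y = IZR (- half_side).
  by rewrite opp_IZR /Rabs; case: Rcase_abs; lra.
have Side (hz : bool) off l t : arcs_ok hz off (- half_side - 1) l ->
    - IZR half_side <= t <= IZR half_side -> on_side hz off t (scaled w) ->
    exists p, domain (pull_word w p 0%C).
  by move=> Ha Ht Ho; apply: (arcs_ok_sound hz off _ l t w Ha _ Ho Hk); rewrite Hlo; lra.
have vertical off : fst (scaled w) - IZR centre_re = IZR off ->
    on_side false off (snd (scaled w) - IZR centre_im) (scaled w).
  by move=> H; rewrite /on_side {1}Ew (plus_IZR centre_re); congr pair; lra.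
have horizontal off : snd (scaled w) - IZR centre_im = IZR off ->
    on_side true off (fst (scaled w) - IZR centre_re) (scaled w).
  by move=> H; rewrite /on_side {1}Ew (plus_IZR centre_im); congr pair; lra.
have [/Habs|/Habs] : Rabs (fst (scaled w) - IZR centre_re) = IZR half_side \/
    Rabs (snd (scaled w) - IZR centre_im) = IZR half_side.
- by move: Hmax; rewrite /Rmax; case: Rle_dec => _ ->; [right|left].
- case=> /vertical Hs; [exact: (Side _ _ _ _ C4 (conj G2 G2') Hs)|].
  exact: (Side _ _ _ _ C3 (conj G2 G2') Hs).
- case=> /horizontal Hs; [exact: (Side _ _ _ _ C2 (conj G1 G1') Hs)|].
  exact: (Side _ _ _ _ C1 (conj G1 G1') Hs).
Qed.

(** A point of the square that is exact in units of [1 / scale], so that [dies] can take parameter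
    error 0. *)
Definition base_re : Z := 1189351114570.
Definition base_im : Z := -845270732670.
Definition base_point : C := (IZR base_re / IZR scale, IZR base_im / IZR scale).

(* A conditional rather than [||], which [vm_compute] would evaluate strictly. *)
Fixpoint dies (n : nat) (B : ball) : bool :=
  if Z.ltb ((bound + rad B) * (bound + rad B)) (sqn (re B) (im B)) then true
  else match n with
  | 0%N => false
  | m.+1 => dies m (ball_pull base_re base_im 0 true B) &&
            dies m (ball_pull base_re base_im 0 false B)
  end.

Lemma scaled_base_point : scaled base_point = gauss base_re base_im.
Proof.
have S0 := scale_gt0.
rewrite /scaled /base_point /gauss /RtoC /Cmult; cbn [fst snd].
by congr pair; field; lra.
Qed.

Lemma base_point_near : Cmod (scaled base_point - gauss centre_re centre_im) <= IZR half_diag.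
Proof. by rewrite scaled_base_point gauss_sub; apply: Cmod_gauss_le; vm_compute. Qed.

(** Once a ball has left the disc, [survives_bound] rules out every continuation. This pruning is
    what spares the enumeration of all words of length [n]. *)
Lemma dies_sound (n : nat) (B : ball) (X : C) :
  dies n B -> in_ball X B -> ~ survives base_point n X.
Proof.
have [Hk Aw] := centre_bounds _ base_point_near.
elim: n B X => [|n IH] B X; cbn [dies];
  case: Z.ltb_spec => [H _|_ H] HX HS //.
1,2: have := lt_Cmod_gauss _ _ _ H; have := survives_bound _ _ _ Aw HS;
     have := Cmod_triangle X (- (X - gauss (re B) (im B)));
     rewrite Cmod_opp (_ : (X + - (X - gauss (re B) (im B)) = gauss (re B) (im B))%C);
     [rewrite plus_IZR; move: HX; rewrite /in_ball; lra | ring].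
case/andP: H => H1 H2; case: HS => e; case: e; [apply: IH H1 _|apply: IH H2 _];
  apply: ball_pull_sound => //; rewrite scaled_base_point /Cminus Cplus_opp_r Cmod_0; exact: Rle_refl.
Qed.

Lemma base_point_dies : ~ survives base_point 48 0%C.
Proof.
have D : dies 48 (Ball 0 0 0) by vm_compute.
have I : in_ball 0%C (Ball 0 0 0).
  rewrite /in_ball; cbn [re im rad].
  by rewrite /gauss -/(RtoC 0) /Cminus Cplus_opp_r Cmod_0; right.
exact (dies_sound 48 (Ball 0 0 0) 0%C D I).
Qed.

End Survival.

(** * Attractors and survival *)

Section Attractor.
Local Open Scope R_scope.

Lemma cabsE (z : Cplx) : cabs z = Cmod z.
Proof. by rewrite /cabs /Cmod RsqrtE !RpowE. Qed.

Definition half_c : C := (/ 2, 0).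

Lemma chalfE : chalf = half_c.
Proof. by []. Qed.

Lemma fmapE (z x : C) : Defs.fmap z x = (z * x)%C.
Proof. by []. Qed.

Lemma gmapE (z x : C) : Defs.gmap z x = (z * (x - 1) + 1)%C.
Proof. by []. Qed.

(* The affine change of variable under which [1/2] is [0] and the two maps become
   [X |-> z X - scale] and [X |-> z X + scale]. *)
Definition position (z X : C) : C := (half_c + (1 - z) * half_c * X * RtoC (/ IZR scale))%C.

Lemma half_c_double : (half_c + half_c)%C = 1%C.
Proof. by rewrite /half_c /Cplus /RtoC; cbn [fst snd]; congr pair; lra. Qed.

Lemma position0 (z : C) : position z 0 = half_c.
Proof. by rewrite /position; ring. Qed.

Definition sign (e : bool) : R := if e then 1 else -1.

Definition branch (e : bool) (z x : C) : C := if e then Defs.gmap z x else Defs.fmap z x.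

(** In the coordinate [position z], a move is an inverse branch of the system: digit [true] undoes
    [gmap] and digit [false] undoes [fmap]. *)
Lemma position_pull (z w : C) (e : bool) (X : C) : (z * w)%C = 1%C ->
  position z X = branch e z (position z (pull w e X)).
Proof.
move=> zw.
have Sn : IZR scale <> 0 by have := scale_gt0; lra.
have SS : (RtoC (IZR scale) * RtoC (/ IZR scale))%C = 1%C.
  by rewrite -RtoC_mult Rinv_r.
have Ed : RtoC (IZR (digit e)) = (RtoC (sign e) * RtoC (IZR scale))%C.
  by rewrite -RtoC_mult; congr RtoC; case: e; rewrite /digit /sign ?opp_IZR; ring.
have zp : (z * pull w e X)%C = (X - RtoC (IZR (digit e)))%C.
  by rewrite /pull (_ : (z * ((X - IZR (digit e)) * w) = (z * w) * (X - IZR (digit e)))%C);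
    [rewrite zw|]; ring.
have zh : (z * position z (pull w e X))%C
   = (z * half_c + (1 - z) * half_c * X * RtoC (/ IZR scale)
      - (1 - z) * half_c * RtoC (sign e))%C.
  rewrite /position (_ : (z * (half_c + (1 - z) * half_c * pull w e X * RtoC (/ IZR scale)))%C
    = (z * half_c + (1 - z) * half_c * (z * pull w e X) * RtoC (/ IZR scale))%C); last by ring.
  rewrite zp Ed (_ : ((1 - z) * half_c * (X - RtoC (sign e) * RtoC (IZR scale)) * RtoC (/ IZR scale))%C
    = ((1 - z) * half_c * X * RtoC (/ IZR scale)
     - (1 - z) * half_c * RtoC (sign e) * (RtoC (IZR scale) * RtoC (/ IZR scale)))%C); last by ring.
  by rewrite SS; ring.
have H1 := half_c_double.
case: e zh {Ed zp}; rewrite /branch /sign => zh; rewrite ?gmapE ?fmapE.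
  rewrite (_ : (z * (position z (pull w true X) - 1) + 1)%C
    = (z * position z (pull w true X) - z + 1)%C); last by ring.
  rewrite zh /position; set T := ((1 - z) * half_c * X * _)%C.
  rewrite (_ : (z * half_c + T - (1 - z) * half_c * 1 - z + 1)%C
    = (z * (half_c + half_c) + T - half_c - z + 1)%C); last by ring.
  rewrite H1 (_ : (z * 1 + T - half_c - z + 1)%C = (1 - half_c + T)%C); last by ring.
  by rewrite -H1; ring.
by rewrite zh (RtoC_opp 1) /position; ring.
Qed.

Lemma branch_inj (z w : C) (e : bool) : (z * w)%C = 1%C -> injective (branch e z).
Proof.
move=> zw x y.
have E (a : C) : a = (w * (z * a))%C.
  by rewrite (_ : (w * (z * a) = z * w * a)%C); [rewrite zw|]; ring.
have F (a b : C) : (z * a)%C = (z * b)%C -> a = b by move=> H; rewrite (E a) (E b) H.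
case: e; rewrite /branch ?gmapE ?fmapE; last exact: F.
move=> H; have /F : (z * (x - 1))%C = (z * (y - 1))%C.
  rewrite (_ : (z * (x - 1) = z * (x - 1) + 1 - 1)%C); last by ring.
  by rewrite H; ring.
move=> H1; rewrite (_ : x = (x - 1 + 1)%C); last by ring.
by rewrite H1; ring.
Qed.

Lemma Cmod_position (z X : C) :
  Cmod (position z X - half_c) = Cmod (1 - z) * Cmod X / (2 * IZR scale).
Proof.
have S0 := scale_gt0.
rewrite (_ : (position z X - half_c)%C = ((1 - z) * half_c * X * RtoC (/ IZR scale))%C);
  last by rewrite /position; ring.
rewrite !Cmod_mult (_ : half_c = RtoC (/ 2)) // !Cmod_R !Rabs_pos_eq.
- by field; lra.
- by left; apply: Rinv_0_lt_compat.
- by lra.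
Qed.

(** * The invariant disc and the limit set of the two contractions *)

Section Radius.
Variables z w : C.
Hypothesis zw : (z * w)%C = 1%C.
Hypothesis Aw : admissible w.

Lemma Cmod_inverse : Cmod z * Cmod w = 1.
Proof. by rewrite -Cmod_mult zw Cmod_1. Qed.

(** This is [admissible w] divided by [scale] and multiplied by [Cmod z], the inverse of
    [Cmod w]. *)
Lemma radius_invariant : Cmod z * IZR bound + IZR scale <= IZR bound.
Proof.
have S0 := scale_gt0; have Hi := Cmod_inverse; have w0 := admissible_gt0 _ Aw.
have z0 := Cmod_ge_0 z.
move: Aw; rewrite /admissible Cmod_scaled => H.
have Hb : IZR bound <= (IZR bound - IZR scale) * Cmod w by nra.
have := Rmult_le_compat_l _ _ _ z0 Hb.
rewrite (_ : Cmod z * ((IZR bound - IZR scale) * Cmod w)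
  = (IZR bound - IZR scale) * (Cmod z * Cmod w)); last by ring.
by rewrite Hi; lra.
Qed.

Lemma Cmod_inverse_lt1 : Cmod z < 1.
Proof.
have S0 := scale_gt0; have H := radius_invariant.
have : 0 < IZR bound by apply: IZR_lt.
by have := Cmod_ge_0 z; nra.
Qed.

(** [position z] shrinks lengths by [|1 - z| / 2 <= 1] after the change of units, so this disc
    contains the image of the survival disc. *)
Definition disc : set C := [set y | Cmod (y - half_c) <= IZR bound / IZR scale].

(** Each branch shifts the centre 1/2 by [(1 - z) / 2] up to sign, of modulus at most 1, which
    [radius_invariant] absorbs. *)
Lemma branch_disc (e : bool) (y : C) : disc y -> disc (branch e z y).
Proof.
rewrite /disc /= => Hy.
have S0 := scale_gt0; have H := radius_invariant.
have E : (branch e z y - half_c)%C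
  = (z * (y - half_c) + RtoC (sign e) * ((1 - z) * half_c))%C.
  have H1 := half_c_double.
  case: e; rewrite /branch /sign ?gmapE ?fmapE.
    have K : (1 - half_c)%C = half_c by rewrite -H1; ring.
    rewrite (_ : (z * (y - half_c) + 1 * ((1 - z) * half_c))%C
      = (z * y - z * (half_c + half_c) + half_c)%C); last by ring.
    by rewrite H1 -{2}K; ring.
  by rewrite (RtoC_opp 1); ring.
rewrite E; apply: Rle_trans (Cmod_triangle _ _) _.
rewrite !Cmod_mult Cmod_R (_ : Rabs (sign e) = 1); last first.
  by case: (e); rewrite /sign ?Rabs_Ropp Rabs_R1.
rewrite (_ : half_c = RtoC (/ 2)) // in Hy *; rewrite Cmod_R Rabs_pos_eq; last by lra.
have H1z : Cmod (1 - z) <= 2.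
  have := Cmod_triangle 1 (- z); rewrite Cmod_opp Cmod_1.
  by have := Cmod_inverse_lt1; rewrite /Cminus; lra.
have := Rmult_le_compat_l _ _ _ (Cmod_ge_0 z) Hy.
have -> : IZR bound / IZR scale = (IZR bound - Cmod z * IZR bound) / IZR scale
    + Cmod z * (IZR bound / IZR scale) by field; lra.
have : 1 <= (IZR bound - Cmod z * IZR bound) / IZR scale.
  by apply/Rle_div_r => //; lra.
by lra.
Qed.

Fixpoint nested (n : nat) : set C :=
  match n with
  | 0%N => disc
  | m.+1 => setU (image (nested m) (Defs.fmap z)) (image (nested m) (Defs.gmap z))
  end.

Lemma nestedS (n : nat) (y : C) :
  nested n.+1 y <-> exists e x, nested n x /\ branch e z x = y.
Proof.
split=> [[[x Hx <-]|[x Hx <-]]|[[] [x [Hx <-]]]].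
- by exists false, x.
- by exists true, x.
- by right; exists x.
- by left; exists x.
Qed.

Lemma nested_decreasing (n : nat) (y : C) : nested n.+1 y -> nested n y.
Proof.
elim: n y => [|n IH] y /nestedS [e [x [Hx <-]]]; first exact: branch_disc.
by apply/nestedS; exists e, x; split=> //; apply: IH.
Qed.

Lemma nested_le (m n : nat) (y : C) : (m <= n)%N -> nested n y -> nested m y.
Proof.
move=> /subnK <-; elim: (n - m)%N => [|k IH] //= H.
by apply: IH; apply: nested_decreasing.
Qed.

(** Read backwards, a surviving orbit writes [position z X] as the image of a point of [disc] under
    [n] branches. *)
Lemma survives_nested (n : nat) (X : C) : survives w n X -> nested n (position z X).
Proof.
elim: n X => [|n IH] X /=.
  move=> HX; rewrite /disc /= Cmod_position; have S0 := scale_gt0.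
  have H1z : Cmod (1 - z) <= 2.
    have := Cmod_triangle 1 (- z); rewrite Cmod_opp Cmod_1.
    by have := Cmod_inverse_lt1; rewrite /Cminus; lra.
  apply/Rle_div_l; first by lra.
  rewrite (_ : IZR bound / IZR scale * (2 * IZR scale) = 2 * IZR bound); last by field; lra.
  by apply: Rmult_le_compat => //; exact: Cmod_ge_0.
case=> e /IH He; apply/nestedS; exists e, (position z (pull w e X)); split=> //.
by rewrite -position_pull.
Qed.

Definition limit_set : set C := [set y | forall n, nested n y].

Lemma limit_setE :
  limit_set = setU (image limit_set (Defs.fmap z)) (image limit_set (Defs.gmap z)).
Proof.
apply/seteqP; split=> y; last first.
  by move=> [] [x Hx <-] [|n]; [apply: (branch_disc false); exact: (Hx 0%N)|
    left; exists x => //; exact: Hx|apply: (branch_disc true); exact: (Hx 0%N)|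
    right; exists x => //; exact: Hx].
move=> Hy.
(* If each branch failed at some stage, both would fail at the later one, by monotonicity of
   [nested]; yet [y] lies in the next nested set. *)
have : exists e, forall n, exists x, nested n x /\ branch e z x = y.
  apply: contrapT => /forallNP H.
  have /existsNP [n Hn] := H false; have /existsNP [m Hm] := H true.
  have /nestedS [[] [x [Hx Ex]]] := Hy (maxn n m).+1.
    by apply: Hm; exists x; split=> //; apply: nested_le Hx; exact: leq_maxr.
  by apply: Hn; exists x; split=> //; apply: nested_le Hx; exact: leq_maxl.
case=> e H; have [x [Hx Ex]] := H 0%N.
(* Injectivity of the branch identifies the preimages found at different stages. *)
have Lx : limit_set x.
  by move=> n; have [x' [Hx' Ex']] := H n; rewrite (branch_inj _ _ e zw _ _ (etrans Ex (esym Ex'))).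
by case: (e) Ex => <-; [right|left]; exists x.
Qed.

End Radius.

End Attractor.

(* Stdlib's [R] only carries the topology of a [realType], not its normed structures, so
   these facts are proved for an abstract [realType]. *)
Section PlaneTopology.
Import Order.TTheory GRing.Theory Num.Theory.
Import numFieldNormedType.Exports.
Local Open Scope ring_scope.
Local Open Scope classical_set_scope.
Variable K : realType.
Implicit Types (f g : K * K -> K) (x y z : K * K).

Let cB f g : continuous f -> continuous g -> continuous (fun x => f x - g x).
Proof. by move=> cf cg x; apply: cvgB; [exact: cf|exact: cg]. Qed.

Let cD f g : continuous f -> continuous g -> continuous (fun x => f x + g x).
Proof. by move=> cf cg x; apply: cvgD; [exact: cf|exact: cg]. Qed.

Let cM f g : continuous f -> continuous g -> continuous (fun x => f x * g x).
Proof. by move=> cf cg x; apply: cvgM; [exact: cf|exact: cg]. Qed.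

Let cC (a : K) : continuous (fun _ : K * K => a).
Proof. by move=> x; exact: cvg_cst. Qed.

Let c1 : continuous (fun x : K * K => x.1).
Proof. by move=> x; exact: cvg_fst. Qed.

Let c2 : continuous (fun x : K * K => x.2).
Proof. by move=> x; exact: cvg_snd. Qed.

Let cP f g : continuous f -> continuous g -> continuous (fun x => (f x, g x)).
Proof. by move=> cf cg x; exact: cvg_pair (cf x) (cg x). Qed.

(** The map is [z (x - a) + b]; [a = b = 0] gives [fmap] and [a = b = 1] gives [gmap]. *)
Lemma continuous_complex_affine z (a b : K * K) : continuous (fun x : K * K =>
  (z.1 * (x.1 - a.1) - z.2 * (x.2 - a.2) + b.1, z.1 * (x.2 - a.2) + z.2 * (x.1 - a.1) + b.2)).
Proof.
by apply: cP; apply: cD => //; [apply: cB|apply: cD]; apply: cM => //; apply: cB.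
Qed.

Lemma continuous_square_gauge (u v r : K) : continuous (fun x : K * K =>
  Num.max `|x.1 - u * (x.1 * x.1 + x.2 * x.2)| `|- x.2 - v * (x.1 * x.1 + x.2 * x.2)|
  - r * (x.1 * x.1 + x.2 * x.2)).
Proof.
have cs : continuous (fun x : K * K => x.1 * x.1 + x.2 * x.2) by apply: cD; exact: cM.
apply: cB; last by apply: cM.
have cmax f g : continuous f -> continuous g -> continuous (fun x => Num.max (f x) (g x)).
  by move=> cf cg x; exact: continuous_max (cf x) (cg x).
have cN f : continuous f -> continuous (fun x => `|f x|).
  by move=> cf x; apply: cvg_norm; exact: cf.
apply: cmax; apply: cN; apply: cB => //; try exact: cM.
by move=> y; apply: cvgN; exact: c2.
Qed.

Lemma compact_plane_disc (a r : K) : 0 <= r ->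
  compact [set y : K * K | (y.1 - a) * (y.1 - a) + y.2 * y.2 <= r * r].
Proof.
move=> r0.
apply: (@subclosed_compact _ _ (`[a - r, a + r] `*` `[- r, r])).
- apply: (@preimage_closed _ _ (fun y : K * K => (y.1 - a) * (y.1 - a) + y.2 * y.2)
    [set t | t <= r * r]); last exact: closed_le.
  by move=> y _; apply: cD; apply: cM => //; exact: cB.
- by apply: compact_setX; exact: segment_compact.
- move=> y /= Hy.
  have A (p q : K) : p * p + q * q <= r * r -> `|p| <= r.
    move=> H; rewrite -(@ler_pXn2r _ 2) ?nnegrE // real_normK ?num_real // !expr2.
    by apply: le_trans H; rewrite lerDl -expr2 sqr_ge0.
  split; rewrite /= in_itv /=; first by rewrite -ler_distl; exact: A Hy.
  by rewrite -ler_norml; apply: (A _ (y.1 - a)); rewrite addrC.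
Qed.

Lemma closed_bigcap_compact (F : nat -> set (K * K)) :
  (forall n, compact (F n)) -> compact [set y | forall n, F n y].
Proof.
move=> cF; apply: (@subclosed_compact _ _ (F 0%N)) => //.
have -> : [set y | forall n, F n y] = \bigcap_(n in setT) F n.
  by apply/seteqP; split=> y H n //; exact: H.
by apply: closed_bigI => n _; apply: compact_closed => //; exact: norm_hausdorff.
Qed.

Lemma compact_plane_bounded (L : set (K * K)) : compact L ->
  exists M, forall y, L y -> `|y.1| <= M /\ `|y.2| <= M.
Proof.
move=> /compact_bounded [M [_ HM]].
have M1 : M < M + 1 by rewrite ltrDl.
exists (M + 1) => y Ly; have := HM _ M1 _ Ly.
by rewrite /= prod_normE ge_max => /andP[].
Qed.

(** The image of [A] is an interval. Applied to [gauge], this forces a connected set to cross the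
    boundary of the square. *)
Lemma connected_zero (A : set (K * K)) f x y : connected A -> continuous f ->
  A x -> A y -> f x < 0 -> 0 < f y -> exists z, A z /\ f z = 0.
Proof.
move=> cA cf Ax Ay fx fy.
have /connected_intervalP I := connected_continuous_connected cA (continuous_subspaceT cf).
have [z Az fz] : (f @` A) 0.
  by apply: (I (f x) (f y)); [exists x|exists y|rewrite !ltW].
by exists z.
Qed.

End PlaneTopology.

(** * Attractors through 1/2 correspond to survival of 0 *)

Section Membership.
Local Open Scope R_scope.

Lemma compact_disc : compact (disc : set Cplx).
Proof.
have r0 : 0 <= IZR bound / IZR scale.
  by apply: Rdiv_le_0_compat; [exact: IZR_le|exact: scale_gt0].
have E (y : C) : Cmod (y - half_c) ^ 2
    = (fst y - / 2) * (fst y - / 2) + snd y * snd y.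
  rewrite /Cmod pow2_sqrt; last by apply: Rplus_le_le_0_compat; exact: pow2_ge_0.
  by rewrite /half_c /Cminus /Cplus /Copp; cbn [fst snd]; ring.
rewrite /disc; move: (IZR bound / IZR scale) r0 => rho r0.
have := @compact_plane_disc R (/ 2) rho (introT RleP r0).
congr (@compact _ _); apply/seteqP; split=> y /=.
  move=> /RleP H.
  have {}H : (fst y - / 2) * (fst y - / 2) + snd y * snd y <= Rsqr rho by exact: H.
  by apply: Rsqr_incr_0_var r0; rewrite Rsqr_pow2 E.
move=> H; apply/RleP.
change ((fst y - / 2) * (fst y - / 2) + snd y * snd y <= Rsqr rho).
by rewrite -E -Rsqr_pow2; apply: Rsqr_incr_1 => //; exact: Cmod_ge_0.
Qed.

Lemma continuous_fmap (z : Cplx) : continuous (Defs.fmap z : Cplx -> Cplx).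
Proof.
have -> : Defs.fmap z = (fun x : Cplx => (z.1 * (x.1 - 0) - z.2 * (x.2 - 0) + 0,
    z.1 * (x.2 - 0) + z.2 * (x.1 - 0) + 0)%R).
  by apply/funext => x; rewrite !GRing.subr0 !GRing.addr0.
exact: (@continuous_complex_affine R z (0, 0) (0, 0)).
Qed.

Lemma continuous_gmap (z : Cplx) : continuous (Defs.gmap z : Cplx -> Cplx).
Proof. exact: (@continuous_complex_affine R z (1, 0) (1, 0)). Qed.

Lemma compact_limit_set (z : Cplx) : compact (limit_set z : set Cplx).
Proof.
apply: (@closed_bigcap_compact R); elim=> [|n IH] /=; first exact: compact_disc.
by apply: compactU; apply: continuous_compact => //;
  apply: continuous_subspaceT; [exact: continuous_fmap|exact: continuous_gmap].
Qed.

(** The witness is [limit_set z]; it contains 1/2 because that is the position of 0. *)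
Lemma survives_attractor (z w : C) : (z * w)%C = 1%C -> admissible w ->
  (forall n, survives w n 0%C) -> exists L, is_attractor z L /\ L chalf.
Proof.
move=> zw Aw Hs; exists (limit_set z).
have H0 : limit_set z chalf.
  by move=> n; rewrite chalfE -(position0 z); apply: survives_nested (Hs n).
split=> //; split; first by exists chalf.
by split; [exact: compact_limit_set|exact: limit_setE zw Aw].
Qed.

(** The points with position in [L] can always be pulled within that set, and a supremum argument
    bounds them by [bound]. *)
Lemma attractor_survives (z w : C) (L : set Cplx) : (z * w)%C = 1%C -> admissible w ->
  is_attractor z L -> L chalf -> forall n, survives w n 0%C.
Proof.
move=> zw Aw [_ [cL EL]] Lh.
have S0 := scale_gt0; have z1 := Cmod_inverse_lt1 _ _ zw Aw.
have Hz : 0 < Cmod (1 - z).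
  have := Cmod_triangle (1 - z) z.
  by rewrite (_ : (1 - z + z)%C = 1%C) ?Cmod_1; [lra|ring].
pose P X := L (position z X).
have Pstep X : P X -> exists e, P (pull w e X).
  have B e y : L y -> branch e z y = position z X -> P (pull w e X).
    move=> Ly Ey; rewrite /P (_ : position z (pull w e X) = y) //.
    by apply: (branch_inj _ _ e zw); rewrite -position_pull.
  rewrite {1}/P {1}EL; case=> [] [y Ly Ey]; 
    [exists false; exact: (B false y)|exists true; exact: (B true y)].
have Pbound X : P X -> Cmod X <= IZR bound.
  have [M HM] : exists M : R, forall y : C, L y -> Rabs (fst y) <= M /\ Rabs (snd y) <= M.
    have [M HM] := @compact_plane_bounded R L cL; exists M => y /HM [/RleP h1 /RleP h2].
    by rewrite -!RabsE in h1 h2; split; [exact: h1|exact: h2].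
  pose E r := exists Y, P Y /\ r = Cmod Y.
  have Eb : Raxioms.bound E.
    (* A position has modulus at most [2 * M], hence distance at most [2 * M + 1] from 1/2;
       [Cmod_position] converts this into a bound on [Y]. *)
    exists ((2 * M + 1) * (2 * IZR scale) / Cmod (1 - z)) => _ [Y [PY ->]].
    have [h1 h2] := HM _ PY.
    apply/Rle_div_r => //; rewrite Rmult_comm; apply/Rle_div_l; first by lra.
    rewrite -Cmod_position; apply: Rle_trans (Cmod_triangle _ _) _.
    rewrite Cmod_opp (_ : half_c = RtoC (/ 2)) // Cmod_R Rabs_pos_eq; last by lra.
    by have := Cmod_le_abs (position z Y); lra.
  move=> PX; have [m [m1 m2]] := completeness E Eb (ex_intro _ _ (ex_intro _ X (conj PX erefl))).
  (* The supremum [m] inherits the recursion [Y = digit e + z * pull w e Y]; with [radius_invariant]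
     this yields [m <= bound]. *)
  have Hm : m <= IZR scale + Cmod z * m.
    apply: m2 => _ [Y [PY ->]].
    have [e Pe] := Pstep Y PY.
    have He : Cmod (pull w e Y) <= m by apply: m1; exists (pull w e Y).
    have EY : Y = (RtoC (IZR (digit e)) + z * pull w e Y)%C.
      rewrite /pull (_ : (z * ((Y - IZR (digit e)) * w) = (z * w) * (Y - IZR (digit e)))%C);
        last by ring.
      by rewrite zw; ring.
    rewrite {1}EY; apply: Rle_trans (Cmod_triangle _ _) _; rewrite Cmod_digit Cmod_mult.
    by have := Rmult_le_compat_l _ _ _ (Cmod_ge_0 z) He; lra.
  have : Cmod X <= m by apply: m1; exists X.
  have := radius_invariant _ _ zw Aw; nra.
have PS n X : P X -> survives w n X.
  elim: n X => [|n IH] X PX /=; first exact: Pbound.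
  by have [e /IH] := Pstep X PX; exists e.
by move=> n; apply: PS; rewrite /P position0.
Qed.

End Membership.

(** * Separation *)

Section Separation.
Local Open Scope R_scope.

Definition square_norm (U : C) : R :=
  Rmax (Rabs (fst U - IZR centre_re)) (Rabs (snd U - IZR centre_im)).

(* [|z|^2 / scale] times the difference of [square_norm (scaled z^-1)] and [half_side],
   in a form that is continuous also at [0]. *)
Definition gauge (z : C) : R :=
  let s := fst z * fst z + snd z * snd z in
  Rmax (Rabs (fst z - IZR centre_re / IZR scale * s))
       (Rabs (- snd z - IZR centre_im / IZR scale * s)) - IZR half_side / IZR scale * s.

Lemma continuous_gauge : continuous (gauge : Cplx -> R).
Proof.
have -> : gauge = (fun x : Cplx =>
    Num.max `|x.1 - (IZR centre_re / IZR scale)%coqR * (x.1 * x.1 + x.2 * x.2)|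
      `|- x.2 - (IZR centre_im / IZR scale)%coqR * (x.1 * x.1 + x.2 * x.2)|
    - (IZR half_side / IZR scale)%coqR * (x.1 * x.1 + x.2 * x.2))%R.
  by apply/funext => x; rewrite /gauge RmaxE !RabsE.
exact: (@continuous_square_gauge R).
Qed.

(** As [1/z] is the conjugate of [z] over [|z|^2], the factor is [|z|^2 / scale]. Thus [gauge] is
    negative, zero or positive as [1/z] is inside, on or outside the square. *)
Lemma gaugeE (z : C) : z <> 0%C -> exists c, 0 < c /\
  gauge z = c * (square_norm (scaled (/ z)) - IZR half_side).
Proof.
move=> z0; have S0 := scale_gt0; have := Cmod_gt_0 z => -[/(_ z0) zm _].
set s := fst z * fst z + snd z * snd z.
have s0 : 0 < s.
  have -> : s = Cmod z ^ 2; last by nra.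
  by rewrite /Cmod pow2_sqrt /s; [ring|nra].
exists (s / IZR scale); split; first by apply: Rdiv_lt_0_compat.
have c0 : 0 <= s / IZR scale by left; apply: Rdiv_lt_0_compat.
have Ez : fst z ^ 2 + snd z ^ 2 = s by rewrite /s; ring.
have E1 : fst z - IZR centre_re / IZR scale * s
    = s / IZR scale * (fst (scaled (/ z)) - IZR centre_re).
  by rewrite /scaled /Cinv /Cmult /RtoC; cbn [fst snd]; rewrite Ez; field; lra.
have E2 : - snd z - IZR centre_im / IZR scale * s
    = s / IZR scale * (snd (scaled (/ z)) - IZR centre_im).
  by rewrite /scaled /Cinv /Cmult /RtoC; cbn [fst snd]; rewrite Ez; field; lra.
rewrite /gauge -/s E1 E2 !(Rabs_mult (s / IZR scale)) (Rabs_pos_eq _ c0) RmaxRmult // /square_norm.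
by field; lra.
Qed.

Lemma Dstar_neq0 (z : C) : Dstar z -> z <> 0%C.
Proof.
rewrite /Dstar /= cabsE => /andP[/RltP H _] E.
by move: H; rewrite E Cmod_0; exact: Rlt_irrefl.
Qed.

Lemma inverse_on_square_M0 (z : C) : Dstar z -> square_norm (scaled (/ z)) = IZR half_side ->
  M0 z.
Proof.
move=> Dz Hs; split=> //.
have z0 := Dstar_neq0 _ Dz.
have [_ Aw] := centre_bounds (/ z) (square_near _ (Req_le _ _ Hs)).
apply: (survives_attractor z (/ z)) => // [|n]; first exact: Cinv_r.
exact: boundary_survives.
Qed.

Definition hole_point : C := (/ base_point)%C.

Lemma base_point_neq0 : base_point <> 0%C.
Proof.
have [_ /admissible_gt0] := centre_bounds _ base_point_near.
by move=> H E; move: H; rewrite E Cmod_0; exact: Rlt_irrefl.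
Qed.

Lemma hole_pointK : (hole_point * base_point)%C = 1%C.
Proof. exact: Cinv_l base_point_neq0. Qed.

Lemma hole_point_out : (Dstar `\` M0)%classic hole_point.
Proof.
have [_ Aw] := centre_bounds _ base_point_near.
have H1 := Cmod_inverse_lt1 _ _ hole_pointK Aw.
split; last first.
  move=> [_ [L [aL Lh]]]; apply: base_point_dies.
  exact: (attractor_survives _ _ L hole_pointK).
have H0 : 0 < Cmod hole_point.
  have := Cmod_inverse _ _ hole_pointK; have := Cmod_ge_0 hole_point.
  by have := Cmod_ge_0 base_point; nra.
by rewrite /Dstar /= cabsE; apply/andP; split; apply/RltP.
Qed.

Lemma gauge_hole_point : gauge hole_point < 0.
Proof.
have hp : hole_point <> 0%C.
  by move=> E; have := hole_pointK; rewrite E Cmult_0_l => /RtoC_inj; lra.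
have [c [c0 ->]] := gaugeE _ hp.
have -> : (/ hole_point)%C = base_point by rewrite /hole_point; field; exact: base_point_neq0.
rewrite scaled_base_point /square_norm /gauss; cbn [fst snd].
rewrite -!minus_IZR -!abs_IZR.
have : Rmax (IZR (Z.abs (base_re - centre_re))) (IZR (Z.abs (base_im - centre_im)))
    < IZR half_side by apply: Rmax_lub_lt; exact: IZR_lt.
by nra.
Qed.

(** Here [|1/z| > 2], while the parameters in the square have modulus at most
    [kappa / scale < 2]. *)
Lemma gauge_small (z : C) : 0 < Cmod z < / 2 -> 0 < gauge z.
Proof.
move=> [z0 z2].
have zn : z <> 0%C by move=> E; move: z0; rewrite E Cmod_0; lra.
have [c [c0 ->]] := gaugeE _ zn; apply: Rmult_lt_0_compat => //.
apply: Rnot_le_lt => H.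
have Hn : square_norm (scaled (/ z)) <= IZR half_side by lra.
have [Hk _] := centre_bounds (/ z) (square_near _ Hn).
move: Hk; rewrite Cmod_scaled Cmod_inv //; apply: Rlt_not_le.
have : IZR kappa < IZR scale * 2 by rewrite -mult_IZR; apply: IZR_lt.
have S0 := scale_gt0.
have : 2 <= / Cmod z.
  by rewrite -(Rinv_inv 2); apply: Rinv_le_contravar; lra.
by nra.
Qed.

End Separation.

Import Order.TTheory GRing.Theory Num.Theory.
Local Open Scope ring_scope.
Local Open Scope classical_set_scope.

(* D^* \ M_0 has a connected component not containing (the points of)
   {z : 0 < |z| < 1/2}, i.e. different from the component containing it. *)
Theorem theorem11p3p1 :
  exists z0 : Cplx, (Dstar `\` M0) z0 /\
    forall w : Cplx, 0 < cabs w < 2^-1 ->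
      ~ connected_component (Dstar `\` M0) z0 w.
Proof.
exists hole_point; split; first exact: hole_point_out.
(* A connected [B] joining the two points outside [M0] must contain a zero of [gauge]. *)
move=> w; rewrite cabsE => /andP[/RltP w0 /RltP w1] [B [Bz BD cB] Bw].
have [z [Bz' gz]] := @connected_zero R B gauge hole_point w cB continuous_gauge Bz Bw
  (introT RltP gauge_hole_point) (introT RltP (gauge_small _ (conj w0 w1))).
have [Dz nM] := BD _ Bz'; apply: nM.
(* Since [c] is positive, the zero has its inverse on the boundary of the square, hence lies in
   [M0]. *)
have [c [c0 Ec]] := gaugeE _ (Dstar_neq0 _ Dz).
apply: inverse_on_square_M0 => //; apply: Rminus_diag_uniq.
by have [E|//] := Rmult_integral _ _ (etrans (esym Ec) gz); move: c0; rewrite E => /Rlt_irrefl.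
Qed.
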